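(* Let $0<|q|<1$. The eighth order mock theta functions satisfy $$S_0^{(8)}(q)=\frac{(-q;q^2)_{\infty}}{(q^2;q^2)_{\infty}}\sum_{n=0}^{\infty}q^{4n^2+n}(1-q^{6n+3})\sum_{j=-n}^{n}(-1)^jq^{-2j^2},$$ $$S_1^{(8)}(q)=\frac{(-q;q^2)_{\infty}}{(q^2;q^2)_{\infty}}\sum_{n=0}^{\infty}q^{4n^2+3n}(1-q^{2n+1})\sum_{j=-n}^{n}(-1)^jq^{-2j^2},$$ $$T_0^{(8)}(q)=q^2\frac{(-q^2;q^2)_{\infty}}{(q^2;q^2)_{\infty}}\sum_{n=0}^{\infty}q^{4n^2+7n}(1-q^{2n+2})\sum_{j=-n-1}^{n}(-1)^jq^{-2j^2-3j},$$ $$T_1^{(8)}(q)=\frac{(-q^2;q^2)_{\infty}}{(q^2;q^2)_{\infty}}\sum_{n=0}^{\infty}q^{4n^2+3n}(1-q^{2n+1})\sum_{j=-n}^{n}(-1)^jq^{-2j^2-j},$$ $$V_0^{(8)}(q)=-1+2\frac{(-q;q^2)_\infty}{(q^2;q^2)_\infty}\sum_{n=0}^{\infty}(-1)^nq^{4n^2+2n}\sum_{j=0}^{2n}q^{-j(j+1)/2}(1+q^{4n+2}),$$ $$V_1^{(8)}(q)=q\frac{(-q;q^2)_{\infty}}{(q^2;q^2)_{\infty}}\sum_{n=0}^{\infty}(-1)^nq^{4n^2+4n}\sum_{j=-n}^{n}q^{-2j^2-j}$$ and $$V_1^{(8)}(q)=q\frac{(-q;q)_\infty}{(q;q)_\infty}\sum_{n=0}^\infty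 (-1)^n\frac{1-q^{2n+1}}{1+q^{4n+2}}q^{n^2+2n}.$$ Furthermore, this last representation is equivalent to the representation $V_1^{(8)}(q)=\frac{(-q^4;q^4)_\infty}{(q^4;q^4)_\infty}\sum_{n=-\infty}^{\infty}\frac{(-1)^nq^{(2n+1)^2}}{1-q^{4n+1}}$, in the sense that $$q\frac{(-q;q)_\infty}{(q;q)_\infty}\sum_{n=0}^\infty (-1)^n\frac{1-q^{2n+1}}{1+q^{4n+2}}q^{n^2+2n}=\frac{(-q^4;q^4)_\infty}{(q^4;q^4)_\infty}\sum_{n=-\infty}^{\infty}\frac{(-1)^nq^{(2n+1)^2}}{1-q^{4n+1}}.$$
   Context: Notation: $(x;p)_0=1$, $(x;p)_n=\prod_{k=0}^{n-1}(1-xp^k)$, $(x;p)_\infty=\prod_{k\ge0}(1-xp^k)$ for $|p|<1$. Definitions of the functions: $$S_0^{(8)}(q)=\sum_{n=0}^{\infty}\frac{q^{n^2}(-q;q^2)_{n}}{(-q^2;q^2)_{n}},\quad S_1^{(8)}(q)=\sum_{n=0}^{\infty}\frac{q^{n(n+2)}(-q;q^2)_{n}}{(-q^2;q^2)_{n}},\quad T_0^{(8)}(q)=\sum_{n=0}^{\infty}\frac{q^{(n+1)(n+2)}(-q^2;q^2)_{n}}{(-q;q^2)_{n+1}},$$ $$T_1^{(8)}(q)=\sum_{n=0}^{\infty}\frac{q^{n(n+1)}(-q^2;q^2)_{n}}{(-q;q^2)_{n+1}},\quad V_0^{(8)}(q)=-1+2\sum_{n=0}^{\infty}\frac{q^{n^2}(-q;q^2)_{n}}{(q;q^2)_n},\quad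 V_1^{(8)}(q)=\sum_{n=0}^{\infty}\frac{q^{(n+1)^2}(-q;q^2)_n}{(q;q^2)_{n+1}}.$$ *)

(* Defs.v *)
From HB Require Import structures.
From mathcomp Require Export all_boot all_order all_algebra.
From mathcomp Require Export all_classical all_reals all_analysis.
From mathcomp Require Export complex.

Set Implicit Arguments.
Unset Strict Implicit.
Unset Printing Implicit Defensive.

Export Order.TTheory GRing.Theory Num.Theory numFieldNormedType.Exports.

Local Open Scope classical_set_scope.
Local Open Scope ring_scope.

(* Everything is stated over an arbitrary numFieldType K because that is where
   the library attaches a topology to the carrier (the one of the norm); with
   K := R[i], R : realType, it is the usual topology of the complex numbers. *)

Section Series.
Variable K : numFieldType.
Implicit Types (u : nat -> K) (v : int -> K) (x p : K).

Definition summable u : Prop := cvgn (series u).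

(* Only meaningful when [summable u]. *)
Definition infsum u : K := limn (series u).

(* A bilateral series converges when both of its halves do. *)
Definition zsummable v : Prop :=
  summable (fun n => v n%:Z) /\ summable (fun n => v (- n.+1%:Z)).

Definition zinfsum v : K :=
  infsum (fun n => v n%:Z) + infsum (fun n => v (- n.+1%:Z)).

(* The sum of v j over the integers a <= j <= b. *)
Definition zsum (a b : int) v : K :=
  \sum_(0 <= i < if a <= b then `|b - a|%N.+1 else 0%N) v (a + i%:Z).

(* (x; p)_n *)
Definition qpoch x p (n : nat) : K := \prod_(0 <= k < n) (1 - x * p ^+ k).

(* (x; p)_oo, only meaningful when the partial products converge. *)
Definition qpoch_inf x p : K := limn (qpoch x p).

Definition qpoch_cvg x p : Prop := cvgn (qpoch x p).

End Series.

Section MockTheta8.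
Variable K : numFieldType.
Implicit Types (q : K) (n : nat).

Definition S0_term q n : K :=
  q ^+ (n ^ 2) * qpoch (- q) (q ^+ 2) n / qpoch (- q ^+ 2) (q ^+ 2) n.

Definition S1_term q n : K :=
  q ^+ (n * (n + 2)) * qpoch (- q) (q ^+ 2) n / qpoch (- q ^+ 2) (q ^+ 2) n.

Definition T0_term q n : K :=
  q ^+ ((n + 1) * (n + 2)) * qpoch (- q ^+ 2) (q ^+ 2) n
  / qpoch (- q) (q ^+ 2) (n + 1).

Definition T1_term q n : K :=
  q ^+ (n * (n + 1)) * qpoch (- q ^+ 2) (q ^+ 2) n
  / qpoch (- q) (q ^+ 2) (n + 1).

Definition V0_term q n : K :=
  q ^+ (n ^ 2) * qpoch (- q) (q ^+ 2) n / qpoch q (q ^+ 2) n.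

Definition V1_term q n : K :=
  q ^+ ((n + 1) ^ 2) * qpoch (- q) (q ^+ 2) n / qpoch q (q ^+ 2) (n + 1).

Definition S0 q : K := infsum (S0_term q).
Definition S1 q : K := infsum (S1_term q).
Definition T0 q : K := infsum (T0_term q).
Definition T1 q : K := infsum (T1_term q).
Definition V0 q : K := - 1 + 2 * infsum (V0_term q).
Definition V1 q : K := infsum (V1_term q).

End MockTheta8.

(* Main.v *)
(* With base p = q^2, every series on the left-hand sides has the form
   sum_j (rho)_j (-1)^j p^(j(j-1)/2) c^j beta_j, to which Bailey's lemma applies:
   its finite form is the terminating very-well-poised 6phi5 summation,
   proved by a WZ certificate, and the limit is Tannery's theorem.  It remains to
   find alpha_n = sum_j (inverse Bailey matrix) beta_j.  For beta_j = 1 / (e)_j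
   creative telescoping in j gives a first-order inhomogeneous recurrence in n,
   and solving it produces the inner sums over j of the Hecke-type series.
   For the last two representations of V1, put x = q and Q = q^2 in
     E(x) = sum_n x^n Q^(n(n+1)/2) (-x;Q)_n / (x;Q)_(n+1),
   which satisfies (1 - x) E(x) = 1 + x Q (1 + x) E(x Q).  The two series
     sum_n x^n (-x;Q)_n (-Q;Q)_n / (-x^2;Q^2)_(n+1)   and
     sum_n (x^2 Q)^n P^(n(n-1)/2) (-P;P)_n / ((xQ;P)_(n+1) (x;P)_(n+1)),  P = Q^2,
   satisfy the same equation, so all three agree; Bailey's lemma turns the two
   series, at x = q, into the two single sums. *)

Require Import Defs.
From mathcomp Require Import ring zify.

Set Implicit Arguments.
Unset Strict Implicit.
Unset Printing Implicit Defensive.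

Local Open Scope classical_set_scope.
Local Open Scope ring_scope.

(** * Geometrically dominated series *)

(** Two reparametrizations keep the degenerate cases of Bailey's lemma inside one rational identity.
    A pair relative to a is indexed by [b] = a p, so that a = 1, where 1 - a vanishes, is an
    ordinary value; the second parameter enters through its inverse [s], so that letting it tend to
    infinity means [s] = 0. Few pairs are needed: the one for S0 also serves S1, and those for T0
    and T1, taken at - q, serve V0 and V1. For S0 and V0 one has a = 1, and alpha_n is a difference
    of two Hecke terms with neighbouring indices, whence an Abel resummation; for the others alpha_n
    is a single Hecke term. The two single sums for V1 come from one further family, beta_n = 1 /
    prod_(k <= n) (1 - t p^k + p^(2k+1)). Its recurrence in n is homogeneous, so alpha_n carries no
    inner sum. All convergence rests on geometric majorants, so completeness enters only through
    [geom_complete]. The inner sums grow like negative powers of q; their own recurrences bound them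
    after normalisation. *)

Section InfiniteSums.
Variable K : numFieldType.
Implicit Types (u v : nat -> K) (x y : K).

Lemma cvgK_lim u x : u @ \oo --> x -> limn u = x.
Proof. by move=> h; apply: cvg_lim. Qed.

Lemma cvgK_unique u x y : u @ \oo --> x -> u @ \oo --> y -> x = y.
Proof. by move=> /cvgK_lim <- /cvgK_lim <-. Qed.

Lemma infsum_eq u x : series u @ \oo --> x -> infsum u = x.
Proof. exact: cvgK_lim. Qed.

Lemma summable_cvg u x : series u @ \oo --> x -> summable u.
Proof. by move=> h; apply/cvg_ex; exists x. Qed.

Lemma infsum_cvg u : summable u -> series u @ \oo --> infsum u.
Proof. by []. Qed.

Lemma cvg_infsumZ c u : summable u ->
  series (fun n => c * u n) @ \oo --> c * infsum u.
Proof.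
move=> /infsum_cvg hu.
have -> : series (fun n => c * u n) = (fun n => c * series u n).
  by apply/funext => n; rewrite /series/= mulr_sumr.
by apply: cvgM => //; exact: cvg_cst.
Qed.

Lemma infsumZ c u : summable u -> infsum (fun n => c * u n) = c * infsum u.
Proof. by move=> us; apply: infsum_eq; exact: cvg_infsumZ. Qed.

Lemma cvg_infsumD u v : summable u -> summable v ->
  series (fun n => u n + v n) @ \oo --> infsum u + infsum v.
Proof.
move=> /infsum_cvg hu /infsum_cvg hv.
have -> : series (fun n => u n + v n) = (fun n => series u n + series v n).
  by apply/funext => n; rewrite /series/= big_split.
exact: cvgD.
Qed.

Lemma infsumD u v : summable u -> summable v ->
  infsum (fun n => u n + v n) = infsum u + infsum v.
Proof. by move=> hu hv; apply: infsum_eq; exact: cvg_infsumD. Qed.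

Lemma cvg_infsumS u : summable (fun n => u n.+1) ->
  series u @ \oo --> u 0%N + infsum (fun n => u n.+1).
Proof.
move=> /infsum_cvg hu; rewrite -cvg_shiftS/=.
have -> : (fun n => series u n.+1) =
    (fun n => u 0%N + series (fun n => u n.+1) n).
  by apply/funext => n; rewrite /series/= big_nat_recl.
by apply: cvgD => //; exact: cvg_cst.
Qed.

Lemma infsumS u : summable (fun n => u n.+1) ->
  infsum u = u 0%N + infsum (fun n => u n.+1).
Proof. by move=> us; apply: infsum_eq; exact: cvg_infsumS. Qed.

Lemma infsum_telescope u x : u @ \oo --> x ->
  infsum (fun n => u n - u n.+1) = u 0%N - x.
Proof.
move=> hu; apply: infsum_eq.
have -> : series (fun n => u n - u n.+1) = (fun n => u 0%N - u n).
  apply/funext => n; rewrite /series/= -opprB -telescope_sumr// -sumrN.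
  by apply: eq_bigr => i _; rewrite opprB.
by apply: cvgB => //; exact: cvg_cst.
Qed.

Lemma geom_sum_le (C r : K) m n : 0 <= C -> 0 <= r < 1 ->
  \sum_(m <= k < n) C * r ^+ k <= C * r ^+ m / (1 - r).
Proof.
move=> C0 /andP[r0 r1]; have r1' : 0 < 1 - r by rewrite subr_gt0.
have [nm|mn] := leqP n m.
  by rewrite big_geq// divr_ge0 ?mulr_ge0 ?exprn_ge0 ?(ltW r1').
rewrite ler_pdivlMr// mulr_suml.
rewrite (eq_bigr (fun k => (- (C * r ^+ k.+1)) - (- (C * r ^+ k)))); last first.
  by move=> k _; rewrite exprS; ring.
rewrite telescope_sumr 1?ltnW// opprK addrC lerBlDr lerDl.
by rewrite mulr_ge0 ?exprn_ge0.
Qed.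

(** The order of [K] is only partial: the reality of [B] is what turns a failure of the bound into
    the strict inequality refuted here. *)
Lemma cvg_norm_le u x B : B \is Num.real -> (forall n, `|u n| <= B) -> u @ \oo --> x -> `|x| <= B.
Proof.
move=> Br uB /cvgrPdist_lt h; rewrite real_leNgt ?normr_real//.
apply/negP => Bx; have : 0 < `|x| - B by rewrite subr_gt0.
move=> /h[N _ /(_ N (leqnn N))]/=.
move=> /(le_lt_trans (lerB_dist _ _)); rewrite ltrD2l ltrN2.
by move=> /lt_le_trans/(_ (uB N)); rewrite ltxx.
Qed.

Definition geom_bounded u :=
  exists C r : K, [/\ 0 <= C, 0 <= r < 1 & forall n, `|u n| <= C * r ^+ n].

Definition bounded u := exists2 B : K, 0 <= B & forall n, `|u n| <= B.

Lemma infsum_norm_le u (C r : K) : summable u -> 0 <= C -> 0 <= r < 1 ->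
  (forall n, `|u n| <= C * r ^+ n) -> `|infsum u| <= C / (1 - r).
Proof.
move=> us C0 r01 h; have /andP[r0 r1] := r01.
apply: (cvg_norm_le _ _ (infsum_cvg us)).
  by rewrite ger0_real// divr_ge0// subr_ge0 ltW.
move=> n; rewrite /series/= (le_trans (ler_norm_sum _ _ _))//.
rewrite (le_trans (ler_sum _ (fun k _ => h k)))//.
by rewrite (le_trans (geom_sum_le _ _ C0 r01))// expr0 mulr1.
Qed.

Lemma bounded_cst x : bounded (fun=> x).
Proof. by exists `|x|. Qed.

Lemma boundedM u v : bounded u -> bounded v -> bounded (fun n => u n * v n).
Proof.
move=> [B B0 uB] [C C0 vC]; exists (B * C); first exact: mulr_ge0.
by move=> n; rewrite normrM ler_pM.
Qed.

Lemma boundedD u v : bounded u -> bounded v -> bounded (fun n => u n + v n).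
Proof.
move=> [B B0 uB] [C C0 vC]; exists (B + C); first exact: addr_ge0.
by move=> n; rewrite (le_trans (ler_normD _ _))// lerD.
Qed.

Lemma boundedX x (f : nat -> nat) : `|x| <= 1 -> bounded (fun n => x ^+ f n).
Proof.
by move=> x1; exists 1 => // n; rewrite normrX exprn_ile1.
Qed.

Lemma geom_boundedM u v : geom_bounded u -> bounded v ->
  geom_bounded (fun n => u n * v n).
Proof.
move=> [C [r [C0 /andP[r0 r1] uC]]] [B B0 vB].
exists (C * B), r; split; rewrite ?mulr_ge0 ?r0// => n.
by rewrite normrM mulrAC ler_pM.
Qed.

Lemma geom_boundedX x (f : nat -> nat) : `|x| < 1 ->
  (forall n, (n <= f n)%N) -> geom_bounded (fun n => x ^+ f n).
Proof.
move=> x1 nf; exists 1, `|x|; rewrite ler01 normr_ge0 x1; split=> // n.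
by rewrite mul1r normrX ler_wiXn2l// ltW.
Qed.

Lemma geom_boundedS u : geom_bounded u -> geom_bounded (fun n => u n.+1).
Proof.
move=> [C [r [C0 /andP[r0 r1] uC]]]; exists (C * r), r.
rewrite r0 r1 mulr_ge0//; split=> // n.
by rewrite (le_trans (uC _))// exprS mulrA.
Qed.

(** The bound M = |u_0| + B / (1 - r) is stable, since r M + B <= M. This is how the normalised
    inner sums of the Hecke-type series are controlled. *)
Lemma bounded_contraction u (k b : nat -> K) (r : K) : 0 <= r < 1 ->
  (forall n, u n.+1 = k n * u n + b n) -> (forall n, `|k n| <= r) ->
  bounded b -> bounded u.
Proof.
move=> /andP[r0 r1] urec kr [B B0 bB]; have r1' : 0 < 1 - r by rewrite subr_gt0.
exists (`|u 0%N| + B / (1 - r)); first by rewrite addr_ge0// divr_ge0// ltW.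
elim=> [|n IH]; first by rewrite lerDl divr_ge0// ltW.
rewrite urec (le_trans (ler_normD _ _))// normrM.
rewrite (le_trans (lerD (ler_pM _ _ (kr n) IH) (bB n)))//.
rewrite mulrDr -addrA lerD ?ler_piMl ?(ltW r1)//.
rewrite -subr_ge0 (_ : _ - _ = 0)//; field; exact: lt0r_neq0.
Qed.

End InfiniteSums.

(* The only form of completeness that is used. *)
Definition geom_complete (K : numFieldType) :=
  forall u : nat -> K, geom_bounded u -> summable u.

(** * Consequences of completeness: bounds on products and Tannery's theorem *)

Section Complete.
Variable K : numFieldType.
Hypothesis Kc : geom_complete K.
Implicit Types (u v : nat -> K) (x y p : K).

Lemma geom_bounded_cvg0 u : geom_bounded u -> u @ \oo --> 0.
Proof. by move=> /Kc; exact: (@cvg_series_cvg_0 _ K^o). Qed.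

(** An ordered field need not be Archimedean, so r^n -> 0 is not automatic; it follows here from the
    convergence of the geometric series. *)
Lemma geom_small (C r e : K) : 0 <= C -> 0 <= r < 1 -> 0 < e ->
  exists N, C * r ^+ N < e.
Proof.
move=> C0 /andP[r0 r1] e0.
have : geom_bounded (fun n => C * r ^+ n).
  by exists C, r; split; rewrite ?r0// => n; rewrite ger0_norm// mulr_ge0 ?exprn_ge0.
move=> /geom_bounded_cvg0/cvgrPdist_lt/(_ _ e0)[N _ /(_ N (leqnn N))]/=.
by rewrite sub0r normrN ger0_norm ?mulr_ge0 ?exprn_ge0// => h; exists N.
Qed.

(** Write a_k = C r^k. Past some N the a_k add up to at most 1/2, and prod (1 + a_k) (1 - sum a_k)
    <= 1 bounds the tail product by 2; neither logarithm nor exponential is used. *)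
Lemma prod_geom_bounded (C r : K) : 0 <= C -> 0 <= r < 1 ->
  exists2 B : K, 0 < B & forall n, \prod_(0 <= k < n) (1 + C * r ^+ k) <= B.
Proof.
move=> C0 r01; have /andP[r0 r1] := r01; have r1' : 0 < 1 - r by rewrite subr_gt0.
have a0 k : 0 <= C * r ^+ k by rewrite mulr_ge0 ?exprn_ge0.
have [|N hN] := @geom_small C r ((1 - r) / 2) C0 r01; first by rewrite divr_gt0.
have tail n : \sum_(N <= k < n) C * r ^+ k <= 2^-1.
  rewrite (le_trans (geom_sum_le _ _ C0 r01))// ler_pdivrMr//.
  by rewrite [leRHS]mulrC ltW.
have prod_tail n : (\prod_(N <= k < n) (1 + C * r ^+ k)) *
    (1 - \sum_(N <= k < n) C * r ^+ k) <= 1.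
  elim: n => [|n IH]; first by rewrite !big_geq// subr0 mulr1.
  have [Nn|nN] := leqP N n; last by rewrite !big_geq// subr0 mulr1.
  rewrite !big_nat_recr//=; apply: le_trans IH; rewrite -mulrA ler_wpM2l//.
    by rewrite prodr_ge0// => k _; rewrite addr_ge0.
  (* The induction step is (1 + a) (1 - s - a) = (1 - s) - (a s + a^2). *)
  rewrite -subr_ge0; set s := \sum_(_ <= _ < _) _; set a := C * _.
  rewrite (_ : _ - _ = a * s + a ^+ 2); last by ring.
  by rewrite addr_ge0 ?mulr_ge0 ?exprn_ge0 ?sumr_ge0.
have P0 m n : 0 < \prod_(m <= k < n) (1 + C * r ^+ k).
  by rewrite prodr_gt0// => k _; rewrite ltr_pwDl.
exists ((\prod_(0 <= k < N) (1 + C * r ^+ k)) * 2); first by rewrite mulr_gt0.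
move=> n; have [Nn|nN] := leqP N n; last first.
  rewrite [in leRHS](big_cat_nat (n := n)) ?(ltnW nN)//= -mulrA.
  rewrite ler_peMr ?(ltW (P0 _ _))// mulr_ege1 ?ler1n//.
  by elim/big_ind: _ => // [a b a1 b1|k _]; rewrite ?mulr_ege1// lerDl.
rewrite (big_cat_nat (n := N))//= ler_pM2l//.
have := prod_tail n; rewrite -ler_pdivlMr; last first.
  by rewrite subr_gt0 (le_lt_trans (tail n))// invf_lt1// ltr1n.
move=> /le_trans; apply; rewrite mul1r -[leRHS]invrK lef_pV2 ?posrE ?invr_gt0//.
- rewrite lerBrDr -lerBrDl (le_trans (tail n))// -subr_ge0.
  by rewrite (_ : _ - _ = 0)//; field.
- by rewrite subr_gt0 (le_lt_trans (tail n))// invf_lt1// ltr1n.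
Qed.

(** Every weight [d n k] has the same limit [l], so it suffices to send the sum of u_k (d n k - l)
    to 0: finitely many terms vanish in the limit, and the tail is uniformly small because |d n k -
    l| <= 2 D. *)
Lemma cvg_tannery u (d : nat -> nat -> K) (D l : K) : geom_bounded u ->
  0 <= D -> (forall n k, (k <= n)%N -> `|d n k| <= D) ->
  (forall k, (fun n => d n k) @ \oo --> l) ->
  (fun n => \sum_(0 <= k < n.+1) u k * d n k) @ \oo --> infsum u * l.
Proof.
move=> ub D0 dD dl; have [C [r [C0 r01 uC]]] := ub; have /andP[r0 r1] := r01.
have r1' : 0 < 1 - r by rewrite subr_gt0.
have us : series u @ \oo --> infsum u by exact/infsum_cvg/Kc.
have -> : (fun n => \sum_(0 <= k < n.+1) u k * d n k) =
    (fun n => series u n.+1 * l + \sum_(0 <= k < n.+1) u k * (d n k - l)).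
  apply/funext => n; rewrite /series/= mulr_suml -big_split/=.
  by apply: eq_bigr => k _; ring.
rewrite -[X in _ --> X]addr0; apply: cvgD.
  by apply: cvgM; [rewrite cvg_shiftS | exact: cvg_cst].
have lD : `|l| <= D.
  have h := dl 0%N; apply: (cvg_norm_le _ _ h); first exact: ger0_real.
  by move=> n; exact: dD.
apply/cvgrPdist_lt => e e0; near \oo => m.
have [N hN] : exists N, C * (2 * D) / (1 - r) * r ^+ N < e / 2.
  by apply: geom_small; rewrite ?divr_gt0// ?divr_ge0 ?mulr_ge0// ltW.
have fin : (fun n => \sum_(0 <= k < N) u k * (d n k - l)) @ \oo --> 0.
  elim: {hN} N => [|N IH].
    rewrite (_ : (fun _ => _) = (fun=> 0)); first exact: cvg_cst.
    by apply/funext => n; rewrite big_nil.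
  rewrite (_ : (fun _ => _) = (fun n => \sum_(0 <= k < N) u k * (d n k - l) +
      u N * (d n N - l))); last by apply/funext => n; rewrite big_nat_recr.
  rewrite -[X in _ --> X]addr0; apply: cvgD => //.
  rewrite -[X in _ --> X](mulr0 (u N)); apply: cvgM; first exact: cvg_cst.
  exact/subr_cvg0.
have e20 : 0 < e / 2 by rewrite divr_gt0.
move/cvgrPdist_lt : fin => /(_ _ e20) fin.
near=> n.
have Nn : (N <= n.+1)%N by near: n; exists N => // n /= /leqW.
rewrite sub0r normrN (big_cat_nat (n := N))//=.
rewrite (splitr e) (le_lt_trans (ler_normD _ _))// ltrD//.
  near: n; apply: filterS fin => n; by rewrite sub0r normrN.
apply: le_lt_trans hN; rewrite (le_trans (ler_norm_sum _ _ _))//.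
rewrite (@le_trans _ _ (\sum_(N <= k < n.+1) C * (2 * D) * r ^+ k))//.
  rewrite big_nat_cond [leRHS]big_nat_cond ler_sum// => k /andP[/andP[_ kn] _].
  rewrite normrM mulrAC ler_pM// (le_trans (ler_normB _ _))//.
  by rewrite mulr2n mulrDl mul1r lerD// dD.
by rewrite (le_trans (geom_sum_le _ _ _ r01)) ?mulr_ge0// mulrAC.
Unshelve. all: by end_near.
Qed.

End Complete.

(** * Completeness of the complex numbers *)

Section ComplexComplete.
Variable R : realType.
Local Notation K := (Num.NumField.sort (R[i] : numFieldType)).
Local Notation Re := complex.Re.
Local Notation Im := complex.Im.
Implicit Types (u : nat -> K) (x : K).

Lemma cvg_complex (a b : nat -> R) (l m : R) :
  a @ \oo --> l -> b @ \oo --> m ->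
  (fun n => (a n +i* b n)%C : K) @ \oo --> ((l +i* m)%C : K).
Proof.
move=> al bm; apply/cvgrPdist_lt => e e0.
have e_real : e = (Re e)%:C%C by rewrite RRe_real// gtr0_real.
have e20 : 0 < Re e / 2 by rewrite divr_gt0//; move: e0; rewrite e_real ltcR.
move/cvgrPdist_lt : al => /(_ _ e20) al.
move/cvgrPdist_lt : bm => /(_ _ e20) bm.
near=> n.
have -> : ((l +i* m) - (a n +i* b n) = (l - a n)%:C + 'i * (m - b n)%:C)%C.
  by rewrite [LHS]complexE.
apply: le_lt_trans (ler_normD _ _) _; rewrite normrM !normc_def/=.
rewrite !(expr0n,expr1n,addr0,add0r)/= !sqrtr_sqr sqrtr1 mul1r -rmorphD/=.
rewrite e_real ltcR [ltRHS]splitr ltrD//; near: n; [exact: al|exact: bm].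
Unshelve. all: by end_near.
Qed.

Lemma geom_real_summable (a : nat -> R) (C r : R) : 0 <= C -> 0 <= r < 1 ->
  (forall n, `|a n| <= C * r ^+ n) -> cvgn (series a).
Proof.
move=> C0 /andP[r0 r1] h; apply: normed_cvg.
apply: (@series_le_cvg _ _ (geometric C r)) => //.
- by move=> n; exact: normr_ge0.
- by move=> n; rewrite /geometric/= mulr_ge0 ?exprn_ge0.
- by apply: is_cvg_geometric_series; rewrite ger0_norm.
Qed.

(** The constants of a geometric majorant are nonnegative, hence real, so the real and imaginary
    parts are real series with the same majorant. *)
Lemma complex_geom_complete : geom_complete (R[i] : numFieldType).
Proof.
move=> u [C [r [C0 /andP[r0 r1] h]]].
have C_real : C = (Re C)%:C%C by rewrite RRe_real// ger0_real.
have r_real : r = (Re r)%:C%C by rewrite RRe_real// ger0_real.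
have C0' : 0 <= Re C by move: C0; rewrite C_real lecR.
have r01 : 0 <= Re r < 1 by move: r0 r1; rewrite r_real lecR ltcR => -> ->.
have hn n : `|Re (u n)| <= Re C * Re r ^+ n.
  rewrite -lecR (le_trans (normc_ge_Re _))// (le_trans (h n))//.
  by rewrite {1}C_real {1}r_real -rmorphXn -rmorphM.
have hi n : `|Im (u n)| <= Re C * Re r ^+ n.
  (* Multiplying by -i makes the imaginary part a real part, to which the bound |Re z| <= |z|
     applies. *)
  rewrite -lecR (_ : Im (u n) = Re (- ('i%C * u n))); last first.
    by case: (u n) => a b /=; ring.
  rewrite (le_trans (normc_ge_Re _))// normrN normrM normc_def/=.
  rewrite expr0n expr1n add0r sqrtr1 mul1r (le_trans (h n))//.
  by rewrite {1}C_real {1}r_real -rmorphXn -rmorphM.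
have hRe := geom_real_summable C0' r01 hn.
have hIm := geom_real_summable C0' r01 hi.
have := cvg_complex hRe hIm.
set f := (fun _ => _) => hf; apply/cvg_ex; eexists.
suff -> : series u = f by exact: hf.
apply/funext => n; rewrite /f /series/=.
elim: n => [|n IH]; first by rewrite !big_nil.
by rewrite !big_nat_recr//= IH; case: (u n).
Qed.

End ComplexComplete.

(** * The finite Bailey lemma *)

Section QPochhammer.
Variable K : numFieldType.
Implicit Types (x p b c : K).

Lemma qpoch0 x p : qpoch x p 0 = 1.
Proof. by rewrite /qpoch big_nil. Qed.

Lemma qpochS x p n : qpoch x p n.+1 = qpoch x p n * (1 - x * p ^+ n).
Proof. by rewrite /qpoch big_nat_recr. Qed.

Lemma qpochD x p m n :
  qpoch x p (m + n) = qpoch x p m * qpoch (x * p ^+ m) p n.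
Proof.
elim: n => [|n IH]; first by rewrite addn0 qpoch0 mulr1.
by rewrite addnS !qpochS IH exprD !mulrA.
Qed.

Lemma qpochSl x p n : qpoch x p n.+1 = (1 - x) * qpoch (x * p) p n.
Proof. by rewrite -add1n qpochD qpochS qpoch0 mul1r expr0 mulr1. Qed.

Lemma exprbin2 p n : p ^+ 'C(n.+1, 2) = p ^+ 'C(n, 2) * p ^+ n.
Proof. by rewrite binS bin1 exprD. Qed.

(* (1 - b p^(2i-1)) (b)_(i-1), that is (a)_i (1 - a p^(2i)) / (1 - a) with b = a p,
   which also makes sense at a = 1. *)
Definition vwp b p (i : nat) : K :=
  if i is i'.+1 then (1 - b * p ^+ (2 * i').+1) * qpoch b p i' else 1.

(* (1/s; p)_i s^i, which also makes sense at s = 0; there it is the limit of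
   (rho2)_i rho2^-i as rho2 tends to infinity. *)
Definition rpoch s p (i : nat) : K := \prod_(0 <= k < i) (s - p ^+ k).

Lemma rpoch0 s p : rpoch s p 0 = 1.
Proof. by rewrite /rpoch big_nil. Qed.

Lemma rpochS s p n : rpoch s p n.+1 = rpoch s p n * (s - p ^+ n).
Proof. by rewrite /rpoch big_nat_recr. Qed.

(** Each of the n shifted factors s - p^(m+k) releases a factor p^m; hence p^(m n) and the new
    parameter s / p^m. *)
Lemma rpochD s p m n : p != 0 ->
  rpoch s p (m + n) = rpoch s p m * (p ^+ (m * n) * rpoch (s / p ^+ m) p n).
Proof.
move=> p0; elim: n => [|n IH]; first by rewrite addn0 muln0 rpoch0 !mulr1.
rewrite addnS !rpochS IH -mulrA; congr (_ * _); rewrite mulnS !exprD.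
by field; rewrite expf_neq0.
Qed.

Section SixPhiFive.
Variables (p rho c s : K).
Let b := rho * c.
Hypothesis p_neq0 : forall n, qpoch p p n != 0.
Hypothesis c_neq0 : forall n, qpoch c p n != 0.
Hypothesis b_neq0 : forall n, qpoch b p n != 0.
Hypothesis bs_neq0 : forall n, qpoch (b * s) p n != 0.
Hypothesis cs_neq0 : forall n, qpoch (c * s) p n != 0.

(** The summand of the 6phi5 sum divided by its value, so that the total is 1 for every M. In
    classical terms b = a p, rho = rho1, s = 1 / rho2, c = a p / rho1, so that b s = a p / rho2 and
    c s = a p / (rho1 rho2). *)
Let F (M i : nat) : K :=
  vwp b p i * qpoch rho p i * rpoch s p i * c ^+ i * (-1) ^+ i * p ^+ 'C(i, 2)
  * qpoch p p M * qpoch c p M * qpoch (b * s) p M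
  / (qpoch c p i * qpoch (b * s) p i * qpoch p p i * qpoch p p (M - i)
     * qpoch b p (M + i) * qpoch (c * s) p M).

(* WZ certificate: F (M+1) i - F M i = G M (i+1) - G M i. *)
Let G (M i : nat) : K :=
  if i is i'.+1 then
  - p ^+ (M - i') * qpoch b p i' * qpoch rho p i * rpoch s p i * c ^+ i
  * (-1) ^+ i * p ^+ 'C(i, 2) * qpoch p p M * qpoch c p M * qpoch (b * s) p M
  / (qpoch c p i' * qpoch (b * s) p i' * qpoch p p i' * qpoch p p (M - i')
     * qpoch b p (M + i) * qpoch (c * s) p M.+1)
  else 0.

Lemma qpoch_factor_neq0 x n : (forall n, qpoch x p n != 0) -> 1 - x * p ^+ n != 0.
Proof. by move=> /(_ n.+1); rewrite qpochS mulf_eq0 negb_or => /andP[]. Qed.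

Let FG M i : (i <= M)%N -> F M.+1 i - F M i = G M i.+1 - G M i.
Proof.
(* [vwp] and [G] are defined by cases, so i = 0 is checked separately. Otherwise M = k + i + 1
   avoids truncated subtraction, and all products reduce to common ones, leaving a rational
   identity. *)
case: i => [_|i iM].
  have h1 := qpoch_factor_neq0 M b_neq0.
  have h2 := qpoch_factor_neq0 M cs_neq0.
  rewrite /F /G /= !subn0 !addn0 addn1 !qpochS !rpochS !qpoch0 rpoch0 bin_small//.
  move: (p_neq0 M) (c_neq0 M) (b_neq0 M) (bs_neq0 M) (cs_neq0 M) h1 h2.
  have hpM := qpoch_factor_neq0 M p_neq0; move: hpM.
  rewrite exprS expr0 !mulr1 /b.
  move: (qpoch p p M) (qpoch c p M) (qpoch _ p M) (qpoch _ p M) (qpoch _ p M) (p ^+ M).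
  move=> P C B S T y h0 h1 h2 h3 h4 h5 h6 h7; field.
  by do ! [apply/andP; split].
have [k ->] : exists k, M = (k + i.+1)%N by exists (M - i.+1)%N; lia.
have e1 : ((k + i.+1).+1 - i.+1)%N = k.+1 by lia.
have e2 : ((k + i.+1) - i.+1)%N = k by lia.
have e3 : ((k + i.+1) - i)%N = k.+1 by lia.
have e4 : ((k + i.+1) + i.+1)%N = (k + i + i).+2 by lia.
have e5 : ((k + i.+1).+1 + i.+1)%N = (k + i + i).+3 by lia.
have e6 : ((k + i.+1) + i.+2)%N = (k + i + i).+3 by lia.
rewrite /F /G /vwp !(e1, e2, e3, e4, e5, e6).
have f1 := qpoch_factor_neq0 (k + i.+1) cs_neq0.
have f2 := qpoch_factor_neq0 (k + i + i).+2 b_neq0.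
have f3 := qpoch_factor_neq0 k p_neq0.
have f4 := qpoch_factor_neq0 i p_neq0.
have f5 := qpoch_factor_neq0 i c_neq0.
have f6 := qpoch_factor_neq0 i bs_neq0.
have n1 := cs_neq0 (k + i.+1).
have n2 := b_neq0 (k + i + i).+2.
have n3 := p_neq0 k. have n4 := p_neq0 i. have n5 := c_neq0 i. have n6 := bs_neq0 i.
rewrite (qpochS _ _ (k + i.+1)) (qpochS c _ (k + i.+1)) (qpochS (b * s) _ (k + i.+1))
  (qpochS (c * s) _ (k + i.+1)) (qpochS b _ (k + i + i).+2) (qpochS _ _ k)
  (qpochS p p i) (qpochS c p i) (qpochS (b * s) p i) (qpochS b p i)
  (qpochS rho p i.+1) (rpochS s p i.+1) !exprS !exprbin2 !addnS !mul2n -addnn !exprD !exprS.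
move: f1 f2 f3 f4 f5 f6 n1 n2 n3 n4 n5 n6; rewrite ?addnS ?exprS ?exprD /b.
move: (qpoch p p (k + i).+1) (qpoch c p (k + i).+1) (qpoch _ p (k + i).+1)
  (qpoch (c * s) p (k + i).+1) (qpoch (rho * c) p (k + i + i).+2) (qpoch p p k)
  (qpoch p p i) (qpoch c p i) (qpoch (rho * c * s) p i) (qpoch (rho * c) p i)
  (qpoch rho p i.+1) (rpoch s p i.+1) (p ^+ k) (p ^+ i) (c ^+ i) ((-1) ^+ i) (p ^+ 'C(i, 2)).
move=> a1 a2 a3 a4 a5 a6 a7 a8 a9 a10 a11 a12 y z ci si pi.
move=> *; field.
by do ! [apply/andP; split].
Qed.

Let F_last M : F M.+1 M.+1 = - G M M.+1.
Proof.
have f1 := qpoch_factor_neq0 M c_neq0.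
have f2 := qpoch_factor_neq0 M bs_neq0.
have f3 := qpoch_factor_neq0 M p_neq0.
have f4 := qpoch_factor_neq0 (M + M).+1 b_neq0.
have n1 := c_neq0 M. have n2 := bs_neq0 M. have n3 := p_neq0 M.
have n4 := b_neq0 (M + M).+1. have n5 := cs_neq0 M.+1.
rewrite /F /G /vwp !subnn !addSn !addnS !qpoch0 expr0 mul2n -addnn.
rewrite (qpochS _ _ (M + M).+1) (qpochS p p M) (qpochS c p M) (qpochS (b * s) p M).
move: f1 f2 f3 f4 n1 n2 n3 n4 n5; rewrite /b.
move: (qpoch _ p (M + M).+1) (qpoch p p M) (qpoch c p M) (qpoch (rho * c * s) p M)
  (qpoch (c * s) p M.+1) (p ^+ (M + M).+1) (p ^+ M) (p ^+ 'C(M.+1, 2)).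
move=> *; field.
by do ! [apply/andP; split].
Qed.

Lemma six_phi_five M :
  \sum_(0 <= i < M.+1)
    vwp (rho * c) p i * qpoch rho p i * rpoch s p i * c ^+ i * (-1) ^+ i
    * p ^+ 'C(i, 2) * qpoch p p M * qpoch c p M * qpoch (rho * c * s) p M
    / (qpoch c p i * qpoch (rho * c * s) p i * qpoch p p i * qpoch p p (M - i)
       * qpoch (rho * c) p (M + i) * qpoch (c * s) p M) = 1.
Proof.
rewrite -/b -[LHS]/(\sum_(0 <= i < M.+1) F M i).
elim: M => [|M IH].
  by rewrite big_nat1 /F /vwp /= !qpoch0 rpoch0 !expr0 !mulr1 divr1.
have h : \sum_(0 <= i < M.+1) (F M.+1 i - F M i) = G M M.+1 - G M 0.
  by apply: telescope_sumr_eq => // i /andP[_ iM]; exact: FG.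
rewrite big_nat_recr//= F_last -[RHS]IH.
by move: h; rewrite sumrB subr0 => /(canRL (subrK _)) ->; rewrite addrAC subrr add0r.
Qed.

End SixPhiFive.

(* Entries of the inverse of the matrix 1 / ((p)_(n-r) (b)_(n+r)), where b = a p for
   a Bailey pair relative to a. *)
Definition bailey_inv b p (r j : nat) : K :=
  if r is 0 then 1 else
  (1 - b * p ^+ (2 * r).-1) * qpoch b p (r + j).-1
  * (-1) ^+ (r - j) * p ^+ 'C(r - j, 2) / qpoch p p (r - j).

#[global] Arguments bailey_inv : simpl never.

Definition bailey_alpha b p (beta : nat -> K) (r : nat) : K :=
  \sum_(0 <= j < r.+1) bailey_inv b p r j * beta j.

(** Read down column j, the inverse matrix is again very well poised, with b replaced by b p^(2j).
    This is what makes the inner sum in [finite_bailey] an instance of [six_phi_five]. *)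
Lemma bailey_invE b p i j :
  bailey_inv b p (j + i) j
  = qpoch b p (2 * j) * vwp (b * p ^+ (2 * j)) p i * (-1) ^+ i * p ^+ 'C(i, 2)
    / qpoch p p i.
Proof.
rewrite /bailey_inv addKn.
case: i => [|i].
  rewrite addn0 /= ?qpoch0 ?expr0 ?mulr1 ?divr1; case: j => [|j];
    rewrite ?qpoch0 ?expr0 ?mulr1 ?divr1//.
  have e1 : (2 * j.+1).-1 = (j + j).+1 by lia.
  have e2 : (j.+1 + j.+1).-1 = (j + j).+1 by lia.
  have e3 : (2 * j.+1)%N = (j + j).+2 by lia.
  by rewrite e1 e3 addnS addSn /= (qpochS _ _ (j + j).+1) mulrC.
rewrite addnS /vwp (_ : (2 * (j + i).+1).-1 = (2 * j + (2 * i).+1)%N); last by lia.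
rewrite (_ : ((j + i).+1 + j).-1 = (2 * j + i)%N); last by lia.
by rewrite qpochD exprD; congr (_ / _); ring.
Qed.

Lemma exchange_triangle (F : nat -> nat -> K) n :
  \sum_(0 <= r < n.+1) \sum_(0 <= j < r.+1) F r j
  = \sum_(0 <= j < n.+1) \sum_(0 <= i < (n - j).+1) F (j + i)%N j.
Proof.
elim: n => [|n IH]; first by rewrite !big_nat1.
rewrite big_nat_recr//= IH [RHS]big_nat_recr//= subnn big_nat1 addn0.
rewrite [X in _ + X]big_nat_recr//= addrA -big_split/=; congr (_ + _).
apply: eq_big_nat => j /andP[_ jn].
by rewrite subSn// [RHS]big_nat_recr//= -subSn// subnKC// ltnW.
Qed.

Section FiniteBailey.
Variables (p rho c s : K) (beta : nat -> K).
Hypothesis p_neq0 : p != 0.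
Hypothesis pp_neq0 : forall n, qpoch p p n != 0.
Hypothesis c_neq0 : forall n, qpoch c p n != 0.
Hypothesis b_neq0 : forall n, qpoch (rho * c) p n != 0.
Hypothesis bs_neq0 : forall n, qpoch (rho * c * s) p n != 0.
Hypothesis cs_neq0 : forall n, qpoch (c * s) p n != 0.

Lemma qpoch_shift_neq0 x m : (forall n, qpoch x p n != 0) ->
  forall n, qpoch (x * p ^+ m) p n != 0.
Proof.
by move=> h n; have := h (m + n)%N; rewrite qpochD mulf_eq0 negb_or => /andP[].
Qed.

(** Expanding alpha and exchanging the sums, the coefficient of beta_j is a 6phi5 sum of length N -
    j with rho and c multiplied by p^j and s divided by p^j; the product c s is unchanged. *)
Lemma finite_bailey N :
  \sum_(0 <= r < N.+1)
    qpoch rho p r * rpoch s p r * c ^+ r / (qpoch c p r * qpoch (rho * c * s) p r)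
    * bailey_alpha (rho * c) p beta r / (qpoch p p (N - r) * qpoch (rho * c) p (N + r))
  = \sum_(0 <= j < N.+1)
    qpoch rho p j * rpoch s p j * c ^+ j * beta j * qpoch (c * s) p (N - j)
    / (qpoch p p (N - j) * qpoch c p N * qpoch (rho * c * s) p N).
Proof.
under eq_bigr => r _.
  rewrite /bailey_alpha mulr_sumr mulr_suml.
  over.
rewrite exchange_triangle; apply: eq_big_nat => j /andP[_ jN].
pose rho' := rho * p ^+ j; pose c' := c * p ^+ j; pose s' := s / p ^+ j.
have pj0 : p ^+ j != 0 by rewrite expf_neq0.
have b'E : rho' * c' = rho * c * p ^+ (2 * j) by rewrite mul2n -addnn exprD /rho' /c'; ring.
have bs'E : rho' * c' * s' = rho * c * s * p ^+ j by rewrite /rho' /c' /s'; field.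
have cs'E : c' * s' = c * s by rewrite /c' /s'; field.
have c'_neq0 n : qpoch c' p n != 0 by exact: qpoch_shift_neq0.
have b'_neq0 n : qpoch (rho' * c') p n != 0 by rewrite b'E; exact: qpoch_shift_neq0.
have bs'_neq0 n : qpoch (rho' * c' * s') p n != 0 by rewrite bs'E; exact: qpoch_shift_neq0.
have cs'_neq0 n : qpoch (c' * s') p n != 0 by rewrite cs'E.
have /(congr1 (fun x => qpoch rho p j * rpoch s p j * c ^+ j * beta j
  * qpoch (c * s) p (N - j) / (qpoch p p (N - j) * qpoch c p N * qpoch (rho * c * s) p N) * x)) :=
  six_phi_five pp_neq0 c'_neq0 b'_neq0 bs'_neq0 cs'_neq0 (N - j).
rewrite mulr1 => <-; rewrite mulr_sumr; apply: eq_big_nat => i /andP[_ iN].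
have -> : N = (j + (N - j))%N by lia.
move: iN; rewrite addKn; move: (N - j)%N => M iM.
have eN : (j + M + (j + i))%N = (2 * j + (M + i))%N by lia.
rewrite subnDl bailey_invE bs'E b'E cs'E eN (qpochD (rho * c) p (2 * j)) (qpochD rho p j i)
  (qpochD c p j i) (qpochD c p j M)
  (qpochD (rho * c * s) p j i) (qpochD (rho * c * s) p j M) rpochD// -/rho' -/c' -/s'.
rewrite (exprD c) [c' ^+ i]exprMn -exprM.
have m1 := pp_neq0 i. have m2 := pp_neq0 (M - i). have m3 := pp_neq0 M.
have m4 := c_neq0 j. have m5 := bs_neq0 j. have m6 := b_neq0 (2 * j).
have m7 := c'_neq0 i. have m8 := c'_neq0 M. have m9 := cs_neq0 M.
move: (bs'_neq0 i) (bs'_neq0 M) (b'_neq0 (M + i)%N); rewrite bs'E b'E.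
move: m1 m2 m3 m4 m5 m6 m7 m8 m9 => *; field.
by do ! [apply/andP; split].
Qed.

End FiniteBailey.
End QPochhammer.

(** * Bailey pairs *)

Section BaileySums.
Variable K : numFieldType.
Implicit Types (x p b c e q : K) (beta : nat -> K).

(** The alpha of a pair relative to a = b, without its factor (1 - a p^(2n)) / (1 - a). Beware of
    the shift: [bailey_alpha b] belongs to a with b = a p. The three lemmas [bailey_alpha_diff],
    [bailey_alpha_prod] and [bailey_alpha_head] translate between the two. *)
Definition bailey_sum b p beta (n : nat) : K :=
  \sum_(0 <= j < n.+1)
    qpoch b p (n + j) * (-1) ^+ (n - j) * p ^+ 'C(n - j, 2) / qpoch p p (n - j)
    * beta j.

Lemma bailey_alpha0 b p beta : bailey_alpha b p beta 0 = beta 0%N.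
Proof. by rewrite /bailey_alpha big_nat1 /bailey_inv mul1r. Qed.

Lemma bailey_invS b p n j :
  bailey_inv b p n.+1 j
  = (1 - b * p ^+ (2 * n).+1) * qpoch b p (n + j)
    * (-1) ^+ (n.+1 - j) * p ^+ 'C(n.+1 - j, 2) / qpoch p p (n.+1 - j).
Proof. by rewrite /bailey_inv (_ : (2 * n.+1).-1 = (2 * n).+1)//; lia. Qed.

(** Relates a pair relative to a to the sum relative to a p. It covers a = 1, where dividing by 1 -
    a is impossible, and is what S0 uses. *)
Lemma bailey_alpha_diff b p beta n : (forall n, qpoch p p n != 0) ->
  bailey_alpha b p beta n.+1
  = bailey_sum b p beta n.+1 - b * p ^+ (2 * n) * bailey_sum b p beta n.
Proof.
move=> pp0; rewrite /bailey_alpha /bailey_sum big_nat_recr//= [in RHS]big_nat_recr//=.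
rewrite bailey_invS subnn addSn (qpochS _ _ (n + n.+1)) (_ : (2 * n).+1 = (n + n.+1)%N); last by lia.
rewrite [RHS]addrAC; congr (_ + _); last by ring.
rewrite mulr_sumr -sumrB; apply: eq_big_nat => j /andP[_ jn]; rewrite bailey_invS.
have [k ->] : exists k, n = (j + k)%N by exists (n - j)%N; lia.
rewrite subSn ?leq_addr// addKn !addSn !qpochS exprbin2 !exprS.
have f1 := qpoch_factor_neq0 k pp0; have n1 := pp0 k.
rewrite mul2n -!addnn !exprD; move: f1; move: (pp0 k) (p ^+ k) (p ^+ j).
move: (qpoch p p k) => P P0 y z f1; field.
by do ! [apply/andP; split].
Qed.

Lemma bailey_alpha_prod b p beta n : 1 - b != 0 ->
  bailey_alpha (b * p) p beta n
  = (1 - b * p ^+ (2 * n)) / (1 - b) * bailey_sum b p beta n.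
Proof.
move=> b1; rewrite /bailey_alpha /bailey_sum mulr_sumr.
apply: eq_big_nat => j /andP[_ jn]; rewrite mulrA; congr (_ * _).
case: n jn => [|n] jn.
  have -> : j = 0%N by lia.
  by rewrite /bailey_inv addn0 subnn muln0 bin0n expr0 !qpoch0 !mulr1 divr1 mulr1 mulfV.
rewrite bailey_invS addSn qpochSl (_ : (2 * n.+1)%N = (2 * n).+2); last by lia.
by rewrite !exprS !mulrA; congr (_ / _); field.
Qed.

(** For a = 1: once the term j = 0 is split off, the remaining terms form the sum relative to p^2
    for the shifted sequence beta_(j+1). V0 needs this form, because its shifted beta is that of T0
    at - q. *)
Lemma bailey_alpha_head p beta n : (forall n, qpoch p p n != 0) ->
  bailey_alpha p p beta n.+1
  = (1 - p ^+ (2 * n.+1)) * ((-1) ^+ n.+1 * p ^+ 'C(n.+1, 2) / (1 - p ^+ n.+1) * beta 0%N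
     + (1 - p) * bailey_sum (p * p) p (fun j => beta j.+1) n).
Proof.
move=> pp0; rewrite /bailey_alpha /bailey_sum big_nat_recl//= mulrDr; congr (_ + _).
  rewrite bailey_invS addn0 subn0 (qpochS p p n) (_ : (2 * n.+1)%N = (2 * n).+2); last by lia.
  have := qpoch_factor_neq0 n pp0; rewrite !exprS => f1.
  by field; rewrite f1 pp0.
rewrite !mulr_sumr; apply: eq_bigr => j _.
rewrite bailey_invS subSS addnS qpochSl (_ : (2 * n.+1)%N = (2 * n).+2); last by lia.
by rewrite !exprS; ring.
Qed.

Section Recurrence.
Variables (b p e : K).
Hypothesis p_neq0 : p != 0.
Hypothesis pp_neq0 : forall n, qpoch p p n != 0.
Hypothesis e_neq0 : forall n, qpoch e p n != 0.

(** Creative telescoping in j. The right-hand side is the lower boundary value -G(0); the upper one,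
    G(n+1), cancels the term j = n + 1 that only D(n+1) has. *)
Lemma bailey_sum_rec n :
  let D := bailey_sum b p (fun j => (qpoch e p j)^-1) in
  (1 - e * p ^+ n) * D n.+1
  - b * p ^+ (2 * n) * (b * p ^+ (2 * n).+1 - e * p ^+ n) * D n
  = (1 - b * p ^+ (2 * n).+1) * p ^+ n * (p - e) * qpoch b p n
    * (-1) ^+ n.+1 * p ^+ 'C(n.+1, 2) / qpoch p p n.+1.
Proof.
set y := p ^+ n; have y2 : p ^+ (2 * n) = y * y by rewrite mul2n -addnn exprD.
have y21 : p ^+ (2 * n).+1 = p * (y * y) by rewrite exprS y2.
(* [X] is the common hypergeometric part of the summands for n and n + 1; [G] multiplies it by the
   rational certificate. *)
pose X j := qpoch b p (n + j) * (-1) ^+ (n.+1 - j) * p ^+ 'C(n.+1 - j, 2)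
  / (qpoch p p (n.+1 - j) * qpoch e p j).
pose G j := - y * p * (1 - b * p * (y * y)) * (p ^+ j)^-1 * (1 - e * p ^+ j / p) * X j.
rewrite /= /bailey_sum big_nat_recr//= subnn addSn.
set S1 := \sum_(_ <= _ < _) _; set S2 := \sum_(_ <= _ < _) _.
have h : (1 - e * y) * S1 - b * p ^+ (2 * n) * (b * p ^+ (2 * n).+1 - e * y) * S2
    = G n.+1 - G 0%N.
  rewrite /S1 /S2 !mulr_sumr -sumrB; apply: telescope_sumr_eq => // j /andP[_ jn].
  rewrite /G /X y21 y2 /y; have [k ->] : exists k, n = (j + k)%N by exists (n - j)%N; lia.
  have ejk : ((j + k).+1 - j)%N = k.+1 by lia.
  rewrite ejk subSS addKn addSn addnS !qpochS exprbin2 !exprS !exprD.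
  have := qpoch_factor_neq0 k pp_neq0; have := pp_neq0 k.
  have := qpoch_factor_neq0 j e_neq0; have := e_neq0 j.
  have : p ^+ j != 0 by rewrite expf_neq0.
  have : p ^+ k != 0 by rewrite expf_neq0.
  move: (qpoch p p k) (qpoch e p j) (p ^+ j) (p ^+ k) (p ^+ 'C(k, 2)) ((-1) ^+ k).
  move: (qpoch b p _) => *; field.
  by do ! [apply/andP; split].
rewrite mulrDr addrAC h /G /X !subnn !subn0 !addn0 !qpoch0 expr0 y21 addnS !qpochS !exprS -/y.
have := e_neq0 n.+1; rewrite qpochS; have := qpoch_factor_neq0 n pp_neq0; have := pp_neq0 n.
rewrite -/y (_ : p ^+ (n + n) = y * y) ?exprD//.

move=> h1 h2; rewrite mulf_eq0 negb_or => /andP[h3 h4].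
field.
have y0 : y != 0 by rewrite expf_neq0.
by do ! [apply/andP; split].
Qed.
End Recurrence.
End BaileySums.

Section ClosedForms.
Variable K : numFieldType.
Implicit Types (x p b c e q : K) (beta : nat -> K).

Lemma zsum_grow (v : int -> K) (a b : int) : a <= b ->
  zsum (a - 1) (b + 1) v = zsum a b v + v (b + 1) + v (a - 1).
Proof.
move=> ab; have [n ->] : exists n : nat, b = a + n%:Z.
  by exists `|b - a|%N; lia.
rewrite /zsum; have -> : (a - 1 <= a + n%:Z + 1) = true by lia.
have -> : (a <= a + n%:Z) = true by lia.
have -> : `|(a + n%:Z + 1 - (a - 1))%R|%N = n.+2 by lia.
have -> : `|(a + n%:Z - a)%R|%N = n by lia.
rewrite big_nat_recl// addrC addr0; congr (_ + _).
rewrite big_nat_recr//=; congr (_ + _); last by congr v; lia.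
by apply: eq_big_nat => i _; congr v; lia.
Qed.

Lemma zsum1 (v : int -> K) (a : int) : zsum a a v = v a.
Proof. by rewrite /zsum lexx subrr big_nat1 addr0. Qed.

Lemma zsum2 (v : int -> K) (a : int) : zsum (a - 1) a v = v (a - 1) + v a.
Proof.
rewrite /zsum (_ : a - 1 <= a = true); last by lia.
rewrite (_ : `|(a - (a - 1))%R|%N = 1%N); last by lia.
by rewrite big_nat_recr// big_nat1/= addr0 subrK.
Qed.

Lemma eq_zsum (v w : int -> K) (a b : int) : v =1 w -> zsum a b v = zsum a b w.
Proof. by move=> vw; apply: eq_bigr => i _. Qed.

Section ThetaQuotient.
Variables (p t : K).
Let R (m : nat) : K := \prod_(0 <= k < m) (1 - t * p ^+ k + p ^+ (2 * k).+1).
Hypothesis p_neq0 : p != 0.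
Hypothesis pp_neq0 : forall n, qpoch p p n != 0.
Hypothesis R_neq0 : forall n, 1 - t * p ^+ n + p ^+ (2 * n).+1 != 0.

(** The factors are (1 - x p^k) (1 - y p^k) with x y = p and x + y = t. The recurrence is
    homogeneous: (1 - t p^n + p^(2n+1)) D_n is multiplied by -p^(n+1) at each step, which integrates
    to the stated power. It is applied with p = q^2, t = 0 and with p = q^4, t = q + q^3. *)
Lemma bailey_sum_theta n :
  bailey_sum p p
    (fun j => (\prod_(0 <= k < j.+1) (1 - t * p ^+ k + p ^+ (2 * k).+1))^-1) n
  = (-1) ^+ n * p ^+ 'C(n.+1, 2) / (1 - t * p ^+ n + p ^+ (2 * n).+1).
Proof.
have -> : bailey_sum p p
    (fun j => (\prod_(0 <= k < j.+1) (1 - t * p ^+ k + p ^+ (2 * k).+1))^-1) n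
  = bailey_sum p p (fun j => (R j.+1)^-1) n by [].
have R0 m : R m != 0.
  elim: m => [|m IH]; rewrite /R ?big_nil ?oner_neq0// big_nat_recr//=.
  by rewrite mulf_neq0// R_neq0.
have RS m : R m.+1 = R m * (1 - t * p ^+ m + p ^+ (2 * m).+1).
  by rewrite /R big_nat_recr.
elim: n => [|n IH].
  rewrite /bailey_sum big_nat1 RS /R big_nil addn0 subnn muln0 !qpoch0 !bin_small// !expr0.
  by rewrite !(mulr1, mul1r, invr1).
set D := bailey_sum _ _ _ in IH *.
set y := p ^+ n; have y2 : p ^+ (2 * n) = y * y by rewrite mul2n -addnn exprD.
have y0 : y != 0 by rewrite expf_neq0.
have y21 : p ^+ (2 * n).+1 = p * (y * y) by rewrite exprS y2.
have y23 : p ^+ (2 * n.+1).+1 = p * (p * y) * (p * y).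
  by rewrite (_ : (2 * n.+1).+1 = (2 * n).+3) ?(exprS, y2); [ring|lia].
suff h : (1 - t * (p * y) + p * (p * y) * (p * y)) * D n.+1
    + p * y * (1 - t * y + p * (y * y)) * D n = 0.
  have := R_neq0 n.+1; have := R_neq0 n.
  move: h; rewrite IH !exprbin2 y23 y21 !exprS -/y => h h1 h2.
  apply: (mulfI h2); move/eqP: h; rewrite addr_eq0 => /eqP ->.
  field; by do ! [apply/andP; split].
pose X j := qpoch p p (n + j) * (-1) ^+ (n.+1 - j) * p ^+ 'C(n.+1 - j, 2)
  / (qpoch p p (n.+1 - j) * R j.+1).
(* The factor 1 - p^(-j) makes the certificate vanish at j = 0, so no inhomogeneous term
   survives. *)
pose G j := p * y * (1 + p * y) * (1 - (p ^+ j)^-1)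
  * (1 - t * p ^+ j + p ^+ (2 * j).+1) * X j.
rewrite /D /bailey_sum big_nat_recr//= subnn addSn.
set S1 := \sum_(_ <= _ < _) _; set S2 := \sum_(_ <= _ < _) _.
have h : (1 - t * (p * y) + p * (p * y) * (p * y)) * S1
    + p * y * (1 - t * y + p * (y * y)) * S2 = G n.+1 - G 0%N.
  rewrite /S1 /S2 !mulr_sumr -big_split/=; apply: telescope_sumr_eq => // j /andP[_ jn].
  rewrite /G /X /y; have [k ->] : exists k, n = (j + k)%N by exists (n - j)%N; lia.
  have ejk : ((j + k).+1 - j)%N = k.+1 by lia.
  have e2 : p ^+ (2 * j).+1 = p * (p ^+ j * p ^+ j) by rewrite exprS mul2n -addnn exprD.
  have e3 : p ^+ (2 * j.+1).+1 = p * p * p * (p ^+ j * p ^+ j).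
    by rewrite (_ : (2 * j.+1).+1 = (2 * j).+1.+2) ?(exprS _ (2 * j).+1.+1)
      ?(exprS _ (2 * j).+1) ?e2; [ring|lia].
  rewrite ejk subSS addKn !addSn addnS !qpochS !RS e2 e3 exprbin2 !exprS !exprD.
  have := qpoch_factor_neq0 k pp_neq0; have := pp_neq0 k.
  have := R_neq0 j; have := R_neq0 j.+1; have := R0 j; rewrite e2 e3 exprS.
  have : p ^+ j != 0 by rewrite expf_neq0.
  have : p ^+ k != 0 by rewrite expf_neq0.
  move: (qpoch p p k) (R j) (p ^+ j) (p ^+ k) (p ^+ 'C(k, 2)) ((-1) ^+ k).
  move: (qpoch p p _) => *; field.
  by do ! [apply/andP; split].
rewrite mulrDr addrAC h /G /X !subnn !subn0 !addn0 expr0 invr1 subrr mulr0 !mul0r subr0.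
rewrite !qpoch0 expr0 addnS !qpochS y23 !exprS -/y exprD -/y.
have := R_neq0 n.+1; have := R0 n.+2; rewrite RS y23 exprS -/y => h2 h3.
have h1 := R0 n.+1.
field.
by do ! [apply/andP; split].
Qed.

End ThetaQuotient.
End ClosedForms.

(** * The inner sums of the Hecke-type series and their Bailey pairs *)

Section HeckeSums.
Variable K : numFieldType.
Implicit Types (x q : K).

Lemma exprz_eqN x (j : int) m : j = - m%:Z -> x ^ j = (x ^+ m)^-1.
Proof. by move=> ->; rewrite -exprnN. Qed.

Lemma exprz_eq x (j : int) m : j = m%:Z -> x ^ j = x ^+ m.
Proof. by move=> ->. Qed.

Lemma signz_eqN (j : int) m : j = - m%:Z -> (-1) ^ j = (-1) ^+ m :> K.
Proof. by move=> /exprz_eqN ->; rewrite -exprVn invrN1. Qed.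

Lemma sqr_exprbin2 q n : (q ^+ 2) ^+ 'C(n.+1, 2) = q ^+ (n * n + n).
Proof.
elim: n => [|n IH]; first by rewrite bin_small.
by rewrite exprbin2 IH -exprM -exprD; congr (_ ^+ _); lia.
Qed.

Definition weightS q (j : int) : K := (-1) ^ j * q ^ (- 2%:Z * j ^+ 2).
Definition weightT q (j : int) : K := (-1) ^ j * q ^ (- 2%:Z * j ^+ 2 - j).
Definition weightT0 q (j : int) : K :=
  (-1) ^ j * q ^ (- 2%:Z * j ^+ 2 - 3%:Z * j).

Definition heckeS q (n : nat) : K := zsum (- n%:Z) n%:Z (weightS q).
Definition heckeT q (n : nat) : K := zsum (- n%:Z) n%:Z (weightT q).
Definition heckeT0 q (n : nat) : K := zsum (- n%:Z - 1) n%:Z (weightT0 q).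

Section Sums.
Variable q : K.
Hypothesis q0 : q != 0.
Lemma heckeS0 : heckeS q 0 = 1.
Proof.
by rewrite /heckeS zsum1 /weightS !(@exprz_eqN _ _ 0) ?expr0 ?invr1 ?mulr1//; lia.
Qed.

Lemma heckeS_rec n :
  heckeS q n.+1 = heckeS q n + 2 * ((-1) ^+ n.+1 * (q ^+ (2 * n.+1 ^ 2))^-1).
Proof.
rewrite /heckeS; have -> : - n.+1%:Z = - n%:Z - 1 by lia.
have -> : n.+1%:Z = n%:Z + 1 by lia.
rewrite zsum_grow; last by lia.
rewrite -addrA; congr (_ + _); rewrite /weightS.
rewrite (@exprz_eq _ (n%:Z + 1) n.+1) ?(@signz_eqN (- n%:Z - 1) n.+1); try lia.
rewrite !(@exprz_eqN _ _ (2 * n.+1 ^ 2)); try lia.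
by ring.
Qed.

Lemma heckeT_0 : heckeT q 0 = 1.
Proof.
by rewrite /heckeT zsum1 /weightT !(@exprz_eqN _ _ 0) ?expr0 ?invr1 ?mulr1//; lia.
Qed.

(** The new indices n + 1 and -(n + 1) carry the same sign, and their powers of q differ by 2n +
    2. *)
Lemma heckeT_rec n :
  heckeT q n.+1 = heckeT q n
    + (-1) ^+ n.+1 * (q ^+ (2 * n.+1 ^ 2 + n.+1))^-1 * (1 + q ^+ (2 * n + 2)).
Proof.
rewrite /heckeT; have -> : - n.+1%:Z = - n%:Z - 1 by lia.
have -> : n.+1%:Z = n%:Z + 1 by lia.
rewrite zsum_grow; last by lia.
rewrite -addrA; congr (_ + _); rewrite /weightT.
rewrite (@exprz_eq _ (n%:Z + 1) n.+1) ?(@signz_eqN (- n%:Z - 1) n.+1); try lia.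
rewrite (@exprz_eqN _ _ (2 * n.+1 ^ 2 + n.+1)); last by lia.
rewrite (@exprz_eqN _ _ (2 * n ^ 2 + 3 * n + 1)); last by lia.
have -> : (2 * n.+1 ^ 2 + n.+1 = (2 * n ^ 2 + 3 * n + 1) + (2 * n + 2))%N by lia.
rewrite exprD; field.
by do ! [apply/andP; split]; rewrite expf_neq0.
Qed.

Lemma heckeT0_0 : heckeT0 q 0 = 1 - q.
Proof.
rewrite /heckeT0 zsum2 addrC.
have -> : weightT0 q 0 = 1.
  by rewrite /weightT0 !(@exprz_eqN _ _ 0) ?expr0 ?invr1 ?mulr1//; lia.
by rewrite /weightT0 (@signz_eqN _ 1) ?(@exprz_eq _ _ 1) ?expr1 ?mulN1r//; lia.
Qed.

(** The new indices n + 1 and -n - 2 carry opposite signs, and their powers of q differ by 2n +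
    3. *)
Lemma heckeT0_rec n :
  heckeT0 q n.+1 = heckeT0 q n
    + (-1) ^+ n.+1 * (q ^+ (2 * n.+1 ^ 2 + 3 * n.+1))^-1 * (1 - q ^+ (2 * n + 3)).
Proof.
rewrite /heckeT0; have -> : - n.+1%:Z - 1 = - n%:Z - 1 - 1 by lia.
have -> : n.+1%:Z = n%:Z + 1 by lia.
rewrite zsum_grow; last by lia.
rewrite -addrA; congr (_ + _); rewrite /weightT0.
rewrite (@exprz_eq _ (n%:Z + 1) n.+1) ?(@signz_eqN (- n%:Z - 1 - 1) n.+2); try lia.
rewrite (@exprz_eqN _ _ (2 * n.+1 ^ 2 + 3 * n.+1)); last by lia.
rewrite (@exprz_eqN _ _ (2 * n ^ 2 + 5 * n + 2)); last by lia.
have -> : (2 * n.+1 ^ 2 + 3 * n.+1 = (2 * n ^ 2 + 5 * n + 2) + (2 * n + 3))%N by lia.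
rewrite exprD !exprS; field.
by do ! [apply/andP; split]; rewrite expf_neq0.
Qed.

Hypothesis pp0 : forall n, qpoch (q ^+ 2) (q ^+ 2) n != 0.

Let p0 : q ^+ 2 != 0. Proof. by rewrite expf_neq0. Qed.

(** With b = p and e = -p the homogeneous part of [bailey_sum_rec] is multiplication by p^(3n+2) =
    q^(6n+4), solved by q^(3n^2+n). Dividing by this solution leaves the recurrence of [heckeS]. *)
Lemma bailey_sum_S n : (forall n, qpoch (- q ^+ 2) (q ^+ 2) n != 0) ->
  bailey_sum (q ^+ 2) (q ^+ 2) (fun j => (qpoch (- q ^+ 2) (q ^+ 2) j)^-1) n
  = q ^+ (3 * n ^ 2 + n)
    * heckeS q n.
Proof.
move=> e0; elim: n => [|n IH].
  by rewrite /bailey_sum big_nat1 !qpoch0 heckeS0 bin_small// !expr0 !(mulr1, invr1).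
have := bailey_sum_rec (q ^+ 2) p0 pp0 e0 n.
rewrite /= IH; set D := bailey_sum _ _ _ n.+1.
rewrite heckeS_rec; set Z := heckeS _ _.
have f1 := qpoch_factor_neq0 n pp0; have f2 := qpoch_factor_neq0 n e0.
rewrite qpochS sqr_exprbin2.
(* All exponents are integer combinations of n, n^2 + n and constants, so in the atoms [u], [w] and
   q the claim is a rational identity. *)
set u := q ^+ n; set w := q ^+ (n * n + n).
have u0 : u != 0 by rewrite expf_neq0.
have w0 : w != 0 by rewrite expf_neq0.
have Ey : (q ^+ 2) ^+ n = u ^+ 2 by rewrite -!exprM mulnC.
have Ey2 : (q ^+ 2) ^+ (2 * n) = u ^+ 4 by rewrite -!exprM; congr (_ ^+ _); lia.
have E0 : q ^+ (3 * n ^ 2 + n) = w ^+ 3 / u ^+ 2.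
  apply/(canRL (mulfK _)); rewrite ?expf_neq0//.
  by rewrite -!exprM -exprD; congr (_ ^+ _); lia.
have E1 : q ^+ (3 * n.+1 ^ 2 + n.+1) = w ^+ 3 * u ^+ 4 * q ^+ 4.
  by rewrite -!exprM -!exprD; congr (_ ^+ _); lia.
have E2 : q ^+ (2 * n.+1 ^ 2) = w ^+ 2 * u ^+ 2 * q ^+ 2.
  by rewrite -!exprM -!exprD; congr (_ ^+ _); lia.
rewrite E0 E1 E2 (exprS _ (2 * n)) Ey2 Ey => h.
rewrite Ey in f1 f2.
have f3 : 1 - - q ^+ 2 * u ^+ 2 != 0 by [].
apply: (mulfI f3); move/(canRL (subrK _)): h => ->.
move: (pp0 n) => n1; field; rewrite ?exprMn.
by do ! [apply/andP; split].
Qed.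

Lemma bailey_sumZ b p x (beta : nat -> K) n :
  bailey_sum b p (fun j => x * beta j) n = x * bailey_sum b p beta n.
Proof. by rewrite /bailey_sum mulr_sumr; apply: eq_bigr => j _; rewrite mulrCA. Qed.

Hypothesis e0 : forall n, qpoch (- q) (q ^+ 2) n != 0.

Let e0' n : qpoch (- q * q ^+ 2) (q ^+ 2) n != 0.
Proof. by have := e0 n.+1; rewrite qpochSl mulf_eq0 negb_or => /andP[]. Qed.

Let q1 : 1 - - q != 0.
Proof. by have := e0 1; rewrite qpochSl mulf_eq0 negb_or => /andP[]. Qed.

(** Moves the first factor 1 + q out, so that beta_j has the shape 1 / (e)_j with e = -q^3. *)
Let betaE b n : bailey_sum b (q ^+ 2) (fun j => (qpoch (- q) (q ^+ 2) j.+1)^-1) n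
  = (1 - - q)^-1 * bailey_sum b (q ^+ 2) (fun j => (qpoch (- q * q ^+ 2) (q ^+ 2) j)^-1) n.
Proof.
rewrite -bailey_sumZ /bailey_sum; apply: eq_bigr => j _; congr (_ * _).
by rewrite qpochSl invfM.
Qed.

(** Here the homogeneous multiplier is q^(6n+5) (1 + q^(2n+1)) / (1 + q^(2n+3)); the prefactor on
    the left absorbs the quotient and leaves the recurrence of [heckeT]. *)
Lemma bailey_sum_T n :
  (1 + q ^+ (2 * n + 1))
  * bailey_sum (q ^+ 2) (q ^+ 2) (fun j => (qpoch (- q) (q ^+ 2) j.+1)^-1) n
  = q ^+ (3 * n ^ 2 + 2 * n)
    * heckeT q n.
Proof.
rewrite betaE.
elim: n => [|n IH].
  rewrite /bailey_sum big_nat1 !qpoch0 heckeT_0 bin_small// !expr0 !(mulr1, invr1).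
  by rewrite -[q ^+ _]/q -{1}[q]opprK mulfV.
have := bailey_sum_rec (q ^+ 2) p0 pp0 e0' n.
move: IH; rewrite /=; set D := bailey_sum _ _ _ n; set D' := bailey_sum _ _ _ n.+1.
rewrite heckeT_rec; set Z := heckeT _ _.
have f1 := qpoch_factor_neq0 n pp0; have f2 := qpoch_factor_neq0 n e0'.
have f3 := qpoch_factor_neq0 n e0.
rewrite qpochS sqr_exprbin2.
set u := q ^+ n; set w := q ^+ (n * n + n).
have u0 : u != 0 by rewrite expf_neq0.
have w0 : w != 0 by rewrite expf_neq0.
have Ey : (q ^+ 2) ^+ n = u ^+ 2 by rewrite -!exprM mulnC.
have Ey2 : (q ^+ 2) ^+ (2 * n) = u ^+ 4 by rewrite -!exprM; congr (_ ^+ _); lia.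
have E0 : q ^+ (3 * n ^ 2 + 2 * n) = w ^+ 3 / u.
  apply/(canRL (mulfK _)); rewrite ?expf_neq0//.
  by rewrite -!exprM -exprD; congr (_ ^+ _); lia.
have E1 : q ^+ (3 * n.+1 ^ 2 + 2 * n.+1) = w ^+ 3 * u ^+ 5 * q ^+ 5.
  by rewrite -!exprM -!exprD; congr (_ ^+ _); lia.
have E2 : q ^+ (2 * n.+1 ^ 2 + n.+1) = w ^+ 2 * u ^+ 3 * q ^+ 3.
  by rewrite -!exprM -!exprD; congr (_ ^+ _); lia.
have E3 : q ^+ (2 * n + 2) = u ^+ 2 * q ^+ 2.
  by rewrite -!exprM -!exprD; congr (_ ^+ _); lia.
have E4 : q ^+ (2 * n + 1) = u ^+ 2 * q.
  by rewrite -!exprM -!exprSr; congr (_ ^+ _); lia.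
have E5 : q ^+ (2 * n.+1 + 1) = u ^+ 2 * q ^+ 3.
  by rewrite -!exprM -!exprD; congr (_ ^+ _); lia.
rewrite E0 E1 E2 E3 E4 E5 (exprS _ (2 * n)) Ey2 Ey => IH h.
rewrite Ey in f1 f2 f3.
have f5 : 1 + u ^+ 2 * q != 0 by move: f3; rewrite mulNr opprK mulrC.
have D_eq : D = (1 - - q) * (w ^+ 3 / u * Z) / (1 + u ^+ 2 * q).
  by rewrite -IH; field; rewrite q1 f5.
have f4 : 1 + u ^+ 2 * q ^+ 3 != 0.
  by move: f2; rewrite !mulNr opprK -exprS mulrC.
rewrite D_eq in h; have -> : D' = ((1 - - q * q ^+ 2 * u ^+ 2) * D') / (1 + u ^+ 2 * q ^+ 3).
  by field.
move/(canRL (subrK _)): h => ->.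
move: (pp0 n) => n1; field; rewrite ?exprMn.
by do ! [apply/andP; split].
Qed.

(** With b = q^4 and e = -q^3 the homogeneous multiplier is q^(6n+7), and the prefactor 1 - q^2
    turns the initial value 1 / (1 + q) into [heckeT0 q 0] = 1 - q. *)
Lemma bailey_sum_T0 n :
  (1 - q ^+ 2) * bailey_sum (q ^+ 2 * q ^+ 2) (q ^+ 2)
    (fun j => (qpoch (- q) (q ^+ 2) j.+1)^-1) n
  = q ^+ (3 * n ^ 2 + 4 * n)
    * heckeT0 q n.
Proof.
rewrite betaE.
have q21 : 1 - q ^+ 2 != 0 by have := qpoch_factor_neq0 0 pp0; rewrite expr0 mulr1.
elim: n => [|n IH].
  rewrite /bailey_sum big_nat1 !qpoch0 heckeT0_0.
  by rewrite bin_small// !expr0 !(mulr1, invr1, mul1r); field; exact: q1.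
have := bailey_sum_rec (q ^+ 2 * q ^+ 2) p0 pp0 e0' n.
move: IH; rewrite /=; set D := bailey_sum _ _ _ n; set D' := bailey_sum _ _ _ n.+1.
rewrite heckeT0_rec; set Z := heckeT0 _ _.
have f1 := qpoch_factor_neq0 n pp0; have f2 := qpoch_factor_neq0 n e0'.
have f6 : (1 - q ^+ 2) * qpoch (q ^+ 2 * q ^+ 2) (q ^+ 2) n
    = qpoch (q ^+ 2) (q ^+ 2) n * (1 - q ^+ 2 * (q ^+ 2) ^+ n).
  by rewrite -qpochSl qpochS.
have {f6} -> : qpoch (q ^+ 2 * q ^+ 2) (q ^+ 2) n
    = qpoch (q ^+ 2) (q ^+ 2) n * (1 - q ^+ 2 * (q ^+ 2) ^+ n) / (1 - q ^+ 2).
  by rewrite -f6; field.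
rewrite qpochS sqr_exprbin2.
set u := q ^+ n; set w := q ^+ (n * n + n).
have u0 : u != 0 by rewrite expf_neq0.
have w0 : w != 0 by rewrite expf_neq0.
have Ey : (q ^+ 2) ^+ n = u ^+ 2 by rewrite -!exprM mulnC.
have Ey2 : (q ^+ 2) ^+ (2 * n) = u ^+ 4 by rewrite -!exprM; congr (_ ^+ _); lia.
have E0 : q ^+ (3 * n ^ 2 + 4 * n) = w ^+ 3 * u.
  by rewrite -!exprM -exprD; congr (_ ^+ _); lia.
have E1 : q ^+ (3 * n.+1 ^ 2 + 4 * n.+1) = w ^+ 3 * u ^+ 7 * q ^+ 7.
  by rewrite -!exprM -!exprD; congr (_ ^+ _); lia.
have E2 : q ^+ (2 * n.+1 ^ 2 + 3 * n.+1) = w ^+ 2 * u ^+ 5 * q ^+ 5.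
  by rewrite -!exprM -!exprD; congr (_ ^+ _); lia.
have E3 : q ^+ (2 * n + 3) = u ^+ 2 * q ^+ 3.
  by rewrite -!exprM -!exprD; congr (_ ^+ _); lia.
rewrite E0 E1 E2 E3 (exprS _ (2 * n)) Ey2 Ey => IH h.
rewrite Ey in f1 f2.
have D_eq : D = (1 - - q) * (w ^+ 3 * u * Z) / (1 - q ^+ 2).
  by rewrite -IH; field; rewrite q1 q21.
have f4 : 1 + u ^+ 2 * q ^+ 3 != 0.
  by move: f2; rewrite !mulNr opprK -exprS mulrC.
rewrite D_eq in h; have -> : D' = ((1 - - q * q ^+ 2 * u ^+ 2) * D') / (1 + u ^+ 2 * q ^+ 3).
  by field.
move/(canRL (subrK _)): h => ->.
move: (pp0 n) => n1; field; rewrite ?exprMn.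
by do ! [apply/andP; split].
Qed.

End Sums.
End HeckeSums.

(** * Infinite products and Bailey's lemma *)

Section InfiniteProducts.
Variable K : numFieldType.
Hypothesis Kc : geom_complete K.
Implicit Types (x p q : K).

Lemma qpoch_le (r s : K) : 0 <= r -> 0 <= s < 1 ->
  exists2 B : K, 0 < B &
    forall x p n, `|x| <= r -> `|p| <= s -> `|qpoch x p n| <= B.
Proof.
move=> r0 s01; have [B B0 hB] := prod_geom_bounded Kc r0 s01.
exists B => // x p n xr ps; apply: le_trans (hB n).
rewrite /qpoch normr_prod; apply: ler_prod => k _; rewrite normr_ge0/=.
rewrite (le_trans (ler_normB _ _))// normr1 lerD2l normrM normrX.
by rewrite ler_pM ?exprn_ge0// lerXn2r// nnegrE (le_trans _ ps).
Qed.

(** For t = r s^k <= r one has 1 / (1 - t) <= 1 + t / (1 - r), so inverse products are again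
    dominated by products of the form 1 + C s^k. Uniformity in x and p is needed along the orbits x
    Q^k. *)
Lemma qpochV_le (r s : K) : 0 <= r < 1 -> 0 <= s < 1 ->
  exists2 B : K, 0 < B &
    forall x p n, `|x| <= r -> `|p| <= s ->
      qpoch x p n != 0 /\ `|(qpoch x p n)^-1| <= B.
Proof.
move=> /andP[r0 r1] s01; have /andP[s0 s1] := s01.
have r1' : 0 < 1 - r by rewrite subr_gt0.
have [||B B0 hB] := @prod_geom_bounded _ Kc (r / (1 - r)) s; rewrite ?divr_ge0 ?(ltW r1')//.
exists B => // x p n xr ps.
have xpk k : `|x * p ^+ k| <= r * s ^+ k.
  rewrite normrM normrX ler_pM ?exprn_ge0// lerXn2r// nnegrE (le_trans _ ps)//.
have rsk k : r * s ^+ k <= r by rewrite ler_piMr// exprn_ile1// ltW.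
have low k : 1 - r * s ^+ k <= `|1 - x * p ^+ k|.
  by rewrite (le_trans _ (lerB_dist _ _))// normr1 lerB.
have pos k : 0 < 1 - r * s ^+ k by rewrite subr_gt0 (le_lt_trans (rsk k)).
split.
  rewrite /qpoch prodf_seq_neq0; apply/allP => k _ /=.
  by rewrite -normr_gt0 (lt_le_trans (pos k)).
apply: le_trans (hB n).
rewrite normfV /qpoch normr_prod -prodfV; apply: ler_prod => k _.
rewrite invr_ge0 normr_ge0/=.
rewrite (@le_trans _ _ (1 - r * s ^+ k)^-1)//.
  by rewrite lef_pV2 ?posrE// (lt_le_trans (pos k)).
rewrite -[leLHS]mul1r ler_pdivrMr// -subr_ge0.
set t := r * s ^+ k.
rewrite (_ : _ - _ = t * (r - t) / (1 - r)); last first.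
  by rewrite /t; field; exact: lt0r_neq0.
apply: divr_ge0; last exact: ltW.
by apply: mulr_ge0; [rewrite /t mulr_ge0 ?exprn_ge0|rewrite subr_ge0 rsk].
Qed.

Lemma bounded_qpoch x p : `|p| < 1 -> bounded (qpoch x p).
Proof.
move=> p1; have [||B B0 hB] := @qpoch_le `|x| `|p|; rewrite ?normr_ge0//.
by exists B; [exact: ltW | move=> n; exact: hB].
Qed.

Lemma bounded_qpochV x p : `|x| < 1 -> `|p| < 1 -> bounded (fun n => (qpoch x p n)^-1).
Proof.
move=> x1 p1; have [||B B0 hB] := @qpochV_le `|x| `|p|; rewrite ?normr_ge0//.
by exists B; [exact: ltW | move=> n; have [] := hB x p n (lexx _) (lexx _)].
Qed.

Lemma qpoch_neq0 x p n : `|x| < 1 -> `|p| < 1 -> qpoch x p n != 0.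
Proof.
move=> x1 p1; have [||B B0 hB] := @qpochV_le `|x| `|p|; rewrite ?normr_ge0//.
by have [] := hB x p n (lexx _) (lexx _).
Qed.

(** Consecutive partial products differ by -x p^n (x;p)_n, which is geometrically dominated. *)
Lemma qpoch_is_cvg x p : `|p| < 1 -> qpoch_cvg x p.
Proof.
move=> p1; pose u n := qpoch x p n.+1 - qpoch x p n.
have /Kc/infsum_cvg us : geom_bounded u.
  have -> : u = fun n => p ^+ n * (- x * qpoch x p n).
    by apply/funext => n; rewrite /u qpochS; ring.
  apply: geom_boundedM; first exact: geom_boundedX.
  by apply: boundedM; [exact: bounded_cst | exact: bounded_qpoch].
apply/cvg_ex; exists (infsum u + 1).
have -> : qpoch x p = (fun n => series u n + 1).
  by apply/funext => n; rewrite /series/= telescope_sumr// qpoch0 subrK.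
by apply: cvgD => //; exact: cvg_cst.
Qed.

Lemma qpoch_cvg_inf x p : `|p| < 1 -> qpoch x p @ \oo --> qpoch_inf x p.
Proof. by move=> p1; exact: qpoch_is_cvg. Qed.

Lemma qpoch_inf_eq x p y : qpoch x p @ \oo --> y -> qpoch_inf x p = y.
Proof. exact: cvgK_lim. Qed.

Lemma qpoch_inf_neq0 x p : `|x| < 1 -> `|p| < 1 -> qpoch_inf x p != 0.
Proof.
move=> x1 p1; have [B B0 hB] := bounded_qpochV x1 p1.
have B1 : 0 < B by rewrite (lt_le_trans _ (hB 0%N))// normr_gt0 invr_eq0 qpoch_neq0.
apply/eqP => h; have /cvgrPdist_lt := @qpoch_cvg_inf x p p1; rewrite h.
have : 0 < B^-1 by rewrite invr_gt0.
move=> e0 /(_ _ e0)[N _ /(_ N (leqnn N))]/=; rewrite sub0r normrN.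
rewrite -[ltLHS]invrK ltf_pV2 ?posrE ?invr_gt0 ?normr_gt0 ?qpoch_neq0//.
by rewrite -normfV => /lt_le_trans/(_ (hB N)); rewrite ltxx.
Qed.

Lemma qpoch_infS x p : `|p| < 1 -> qpoch_inf x p = (1 - x) * qpoch_inf (x * p) p.
Proof.
move=> p1; apply: qpoch_inf_eq; rewrite -cvg_shiftS/=.
have -> : (fun n => qpoch x p n.+1) = (fun n => (1 - x) * qpoch (x * p) p n).
  by apply/funext => n; rewrite qpochSl.
by apply: cvgM; [exact: cvg_cst | exact: qpoch_cvg_inf].
Qed.

Lemma qpoch_l0 p n : qpoch 0 p n = 1.
Proof. by rewrite /qpoch big1// => k _; rewrite mul0r subr0. Qed.

Lemma qpoch_inf_l0 p : qpoch_inf 0 p = 1.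
Proof.
apply: qpoch_inf_eq; rewrite (_ : qpoch 0 p = (fun=> 1)); first exact: cvg_cst.
by apply/funext => n; rewrite qpoch_l0.
Qed.

Lemma qpoch_inf_sqr x q : `|q| < 1 ->
  qpoch_inf x q = qpoch_inf x (q ^+ 2) * qpoch_inf (x * q) (q ^+ 2).
Proof.
move=> q1; have q21 : `|q ^+ 2| < 1 by rewrite normrX expr_lte1.
have h : (fun n => qpoch x q (2 * n)) @ \oo --> qpoch_inf x q.
  apply: (@cvg_comp _ _ _ (fun n => (2 * n)%N) (qpoch x q)); last exact: qpoch_cvg_inf.
  by move=> A [N _ hN]; exists N => // n /= Nn; apply: hN => /=; lia.
apply: (cvgK_unique h).
have -> : (fun n => qpoch x q (2 * n)) =
    (fun n => qpoch x (q ^+ 2) n * qpoch (x * q) (q ^+ 2) n).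
  apply/funext; elim=> [|n IH]; first by rewrite muln0 !qpoch0 mulr1.
  rewrite (_ : (2 * n.+1)%N = (2 * n).+2) ?(qpochS, IH); last by lia.
  by rewrite (exprS q (2 * n)) (exprM q 2 n); ring.
by apply: cvgM; exact: qpoch_cvg_inf.
Qed.

Section BaileyLemma.
Variables (p rho c s : K) (beta : nat -> K).
Hypotheses (p0 : p != 0) (p1 : `|p| < 1) (c1 : `|c| < 1) (b1 : `|rho * c| < 1).
Hypotheses (bs1 : `|rho * c * s| < 1) (cs1 : `|c * s| < 1).

Let cvg_qpochV x : `|x| < 1 -> (fun n => (qpoch x p n)^-1) @ \oo --> (qpoch_inf x p)^-1.
Proof. by move=> x1; apply: cvgV; [exact: qpoch_inf_neq0 | exact: qpoch_cvg_inf]. Qed.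

Let shiftB (u : nat -> K) (l : K) k : u @ \oo --> l -> (fun n => u (n - k)%N) @ \oo --> l.
Proof.
move=> ul; rewrite -(cvg_shiftn k)/=.
by have -> : (fun n => u (n + k - k)%N) = u by apply/funext => n; rewrite addnK.
Qed.

Let shiftD (u : nat -> K) (l : K) k : u @ \oo --> l -> (fun n => u (n + k)%N) @ \oo --> l.
Proof. by move=> ul; rewrite (cvg_shiftn k). Qed.

(** Limit N -> oo in [finite_bailey]. For a fixed summation index the N-dependent weights on either
    side tend to a limit independent of that index, so Tannery's theorem applies to both sides and
    uniqueness of limits equates them. *)
Lemma bailey_lemma :
  let w r := qpoch rho p r * rpoch s p r * c ^+ r
    / (qpoch c p r * qpoch (rho * c * s) p r) * bailey_alpha (rho * c) p beta r in
  let o j := qpoch rho p j * rpoch s p j * c ^+ j * beta j in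
  geom_bounded w -> geom_bounded o ->
  infsum o = qpoch_inf c p * qpoch_inf (rho * c * s) p
    / (qpoch_inf (rho * c) p * qpoch_inf (c * s) p) * infsum w.
Proof.
move=> w o wb ob.
have [B1 B10 hB1] := bounded_qpochV p1 p1.
have [B2 B20 hB2] := bounded_qpochV b1 p1.
have [B3 B30 hB3] := bounded_qpoch (c * s) p1.
have hw : (fun N => \sum_(0 <= r < N.+1) w r *
    ((qpoch p p (N - r))^-1 * (qpoch (rho * c) p (N + r))^-1)) @ \oo -->
    infsum w * ((qpoch_inf p p)^-1 * (qpoch_inf (rho * c) p)^-1).
  apply: (cvg_tannery Kc (D := B1 * B2)) => //; first exact: mulr_ge0.
    by move=> n k _; rewrite normrM ler_pM.
  move=> k; apply: cvgM; [exact: (shiftB k (cvg_qpochV p1)) | exact: (shiftD k (cvg_qpochV b1))].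
have ho : (fun N => \sum_(0 <= r < N.+1) o r *
    (qpoch (c * s) p (N - r) * (qpoch p p (N - r))^-1)) @ \oo -->
    infsum o * (qpoch_inf (c * s) p * (qpoch_inf p p)^-1).
  apply: (cvg_tannery Kc (D := B3 * B1)) => //; first exact: mulr_ge0.
    by move=> n k _; rewrite normrM ler_pM.
  move=> k; apply: cvgM; [exact: (shiftB k (@qpoch_cvg_inf _ _ p1))
    | exact: (shiftB k (cvg_qpochV p1))].
have ho' : (fun N => (\sum_(0 <= r < N.+1) o r *
    (qpoch (c * s) p (N - r) * (qpoch p p (N - r))^-1)) *
    ((qpoch c p N)^-1 * (qpoch (rho * c * s) p N)^-1)) @ \oo -->
    infsum o * (qpoch_inf (c * s) p * (qpoch_inf p p)^-1)
    * ((qpoch_inf c p)^-1 * (qpoch_inf (rho * c * s) p)^-1).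
  by apply: cvgM => //; apply: cvgM; exact: cvg_qpochV.
have nz x : `|x| < 1 -> forall n, qpoch x p n != 0 by move=> x1 n; exact: qpoch_neq0.
have e : infsum w * ((qpoch_inf p p)^-1 * (qpoch_inf (rho * c) p)^-1)
    = infsum o * (qpoch_inf (c * s) p * (qpoch_inf p p)^-1)
    * ((qpoch_inf c p)^-1 * (qpoch_inf (rho * c * s) p)^-1).
  apply: cvgK_unique hw _; move: ho'.
  set f := (X in X @ \oo --> _ -> _); set g := (X in _ -> X @ \oo --> _).
  suff -> : f = g by []; apply/funext => N; rewrite /f /g {f g}.
  apply/esym.
  rewrite mulr_suml; under [LHS]eq_bigr => r _ do rewrite -invfM.
  rewrite /w finite_bailey//; try exact: nz.
  by apply: eq_bigr => j _; rewrite /o !invfM !mulrA.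
have := qpoch_inf_neq0 p1 p1; have := qpoch_inf_neq0 b1 p1.
have := qpoch_inf_neq0 c1 p1; have := qpoch_inf_neq0 bs1 p1; have := qpoch_inf_neq0 cs1 p1.
move=> h1 h2 h3 h4 h5.
have -> : infsum w = (infsum w * ((qpoch_inf p p)^-1 * (qpoch_inf (rho * c) p)^-1))
   * (qpoch_inf p p * qpoch_inf (rho * c) p) by field; rewrite h4 h5.
by rewrite e; field; do ! [apply/andP; split].
Qed.

End BaileyLemma.
End InfiniteProducts.

(** * Two solutions of (1 - x) f(x) = 1 + x Q (1 + x) f(x Q) *)

Section Iteration.
Variable K : numFieldType.
Hypothesis Kc : geom_complete K.
Implicit Types (x t p q Q P : K).

Lemma norm_powM_lt1 x p n : `|x| < 1 -> `|p| < 1 -> `|x * p ^+ n| < 1.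
Proof.
move=> x1 p1; rewrite normrM normrX (le_lt_trans _ x1)// ler_piMr//.
by rewrite exprn_ile1// ltW.
Qed.

Lemma subr1_neq0 x : `|x| < 1 -> 1 - x != 0.
Proof. by apply: contraTneq => /eqP; rewrite subr_eq0 => /eqP <-; rewrite normr1 ltxx. Qed.

(** Here f k stands for f(x Q^k). Iterating n times from k = 0 produces the partial sum plus a
    remainder [r n * f n] that tends to 0 when f is bounded, so the functional equation has only one
    solution bounded along the orbit. *)
Lemma iterated_recurrence x Q (f : nat -> K) : `|x| < 1 -> `|Q| < 1 -> bounded f ->
  (forall k, (1 - x * Q ^+ k) * f k
     = 1 + x * Q ^+ k * Q * (1 + x * Q ^+ k) * f k.+1) ->
  infsum (fun n => x ^+ n * Q ^+ 'C(n.+1, 2) * qpoch (- x) Q n / qpoch x Q n.+1)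
  = f 0%N.
Proof.
move=> x1 Q1 fb rec; apply: infsum_eq.
pose r n := x ^+ n * Q ^+ 'C(n.+1, 2) * qpoch (- x) Q n / qpoch x Q n.
set u := fun n => _.
have partial n : series u n = f 0%N - r n * f n.
  elim: n => [|n IH].
    by rewrite /series/= big_nil /r bin_small// !qpoch0 !expr0 !(mulr1, invr1, mul1r) subrr.
  rewrite (_ : series u n.+1 = series u n + u n); last by rewrite /series/= big_nat_recr.
  rewrite IH /u /r !exprbin2 !qpochS !exprS.
  have f1 : 1 - x * Q ^+ n != 0 by apply/subr1_neq0/norm_powM_lt1.
  have f2 : qpoch x Q n != 0 by exact: (qpoch_neq0 Kc).
  have -> : f n = (1 - x * Q ^+ n)^-1 * (1 + x * Q ^+ n * Q * (1 + x * Q ^+ n) * f n.+1).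
    by rewrite -rec mulrA mulVf// mul1r.
  by field; rewrite f1 f2.
rewrite (_ : series u = (fun n => f 0%N - r n * f n)); last exact/funext.
rewrite -[X in _ --> X]subr0; apply: cvgB; first exact: cvg_cst.
apply: (geom_bounded_cvg0 Kc); apply: geom_boundedM => //.
have -> : r = (fun n => x ^+ n * (Q ^+ 'C(n.+1, 2) * (qpoch (- x) Q n * (qpoch x Q n)^-1))).
  by apply/funext => n; rewrite /r !mulrA.
apply: geom_boundedM; first exact: geom_boundedX.
apply: boundedM; first by apply: boundedX; exact: ltW.
by apply: boundedM; [exact: bounded_qpoch | exact: bounded_qpochV].
Qed.

(** Proves functional equations of series from a certificate: [G 0] is the inhomogeneous term, equal
    to 1 in both applications. *)
Lemma infsum_sub_telescope u v (G : nat -> K) (a b : K) :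
  summable u -> summable v -> G @ \oo --> 0 ->
  (forall n, a * u n - b * v n = G n - G n.+1) ->
  a * infsum u - b * infsum v = G 0%N.
Proof.
move=> us vs G0 h; rewrite -mulNr -(infsumZ a us) -(infsumZ (- b) vs) -infsumD.
- rewrite -[RHS]subr0 -(infsum_telescope G0); congr infsum.
  by apply/funext => n; rewrite -h mulNr.
- by apply: summable_cvg; exact: cvg_infsumZ.
- by apply: summable_cvg; exact: cvg_infsumZ.
Qed.

Definition k_term Q x (n : nat) : K :=
  x ^+ n * qpoch (- x) Q n * qpoch (- Q) Q n / qpoch (- x ^+ 2) (Q ^+ 2) n.+1.

Lemma norm_sqr_lt1 x : `|x| < 1 -> `|x ^+ 2| < 1.
Proof. by move=> x1; rewrite normrX expr_lte1. Qed.

Lemma k_term_le Q (r : K) : `|Q| < 1 -> 0 <= r < 1 ->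
  exists2 B : K, 0 <= B & forall x n, `|x| <= r -> `|k_term Q x n| <= B * r ^+ n.
Proof.
move=> Q1 /andP[r0 r1].
have [||B1 B10 h1] := @qpoch_le _ Kc 1 `|Q|; rewrite ?normr_ge0//.
have [||B2 B20 h2] := @qpochV_le _ Kc r `|Q|; rewrite ?normr_ge0 ?r0//.
exists (B1 * B1 * B2); first by rewrite !mulr_ge0// ltW.
move=> x n xr; have x1 : `|x| <= 1 by rewrite (le_trans xr)// ltW.
have -> : k_term Q x n = qpoch (- x) Q n * qpoch (- Q) Q n
    * (qpoch (- x ^+ 2) (Q ^+ 2) n.+1)^-1 * x ^+ n by rewrite /k_term; ring.
rewrite !normrM normrX; apply: ler_pM; rewrite ?mulr_ge0 ?exprn_ge0//.
  apply: ler_pM; rewrite ?mulr_ge0//.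
    by apply: ler_pM => //; apply: h1; rewrite ?normrN// ltW.
  have [] := h2 (- x ^+ 2) (Q ^+ 2) n.+1 => //.
  - by rewrite normrN normrX (le_trans _ xr)// expr2 ler_piMl.
  - by rewrite normrX expr2 ler_piMl// ltW.
by rewrite lerXn2r// nnegrE (le_trans _ xr).
Qed.

Lemma k_term_geom Q x : `|Q| < 1 -> `|x| < 1 -> geom_bounded (k_term Q x).
Proof.
move=> Q1 x1; have [|B B0 h] := @k_term_le Q `|x| Q1; first by rewrite normr_ge0.
by exists B, `|x|; rewrite normr_ge0 x1; split=> // n; exact: h.
Qed.

Lemma k_sum_rec Q x : `|Q| < 1 -> `|x| < 1 ->
  (1 - x) * infsum (k_term Q x)
  = 1 + x * Q * (1 + x) * infsum (k_term Q (x * Q)).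
Proof.
move=> Q1 x1; have xQ1 : `|x * Q| < 1 by rewrite -[Q]expr1 norm_powM_lt1.
pose G n := k_term Q x n * (1 + x ^+ 2 * Q ^+ n).
apply/eqP; rewrite -subr_eq; apply/eqP.
have G0 : G 0%N = 1.
  rewrite /G /k_term !qpoch0 qpochS qpoch0 !expr0 !(mulr1, mul1r) opprK mulVf//.
  by rewrite -[x ^+ 2]opprK subr1_neq0// normrN norm_sqr_lt1.
rewrite -[RHS]G0; apply: infsum_sub_telescope.
- by apply: Kc; exact: k_term_geom.
- by apply: Kc; exact: k_term_geom.
- apply: (geom_bounded_cvg0 Kc); apply: geom_boundedM; first exact: k_term_geom.
  apply: boundedD; first exact: bounded_cst.
  by apply: boundedM; [exact: bounded_cst | apply: boundedX; exact: ltW].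
move=> n; rewrite /G /k_term.
have e1 : qpoch (- (x * Q) ^+ 2) (Q ^+ 2) n.+1 = qpoch (- x ^+ 2) (Q ^+ 2) n.+2 / (1 + x ^+ 2).
  rewrite [in RHS]qpochSl opprK mulrAC mulfV ?mul1r ?exprMn ?mulNr//.
  by rewrite -[x ^+ 2]opprK subr1_neq0// normrN norm_sqr_lt1.
have e2 : qpoch (- (x * Q)) Q n = qpoch (- x) Q n.+1 / (1 + x).
  rewrite [in RHS]qpochSl opprK mulrAC mulfV ?mul1r ?mulNr//.
  by rewrite -[x]opprK subr1_neq0// normrN.
rewrite e1 e2 (qpochS _ _ n.+1) !(qpochS (- x) _ n) !(qpochS (- Q) _ n).
have n1 : qpoch (- x ^+ 2) (Q ^+ 2) n.+1 != 0.
  by apply: (qpoch_neq0 Kc); rewrite ?normrN norm_sqr_lt1.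
have n2 : 1 - - x ^+ 2 * (Q ^+ 2) ^+ n.+1 != 0.
  by apply/subr1_neq0/norm_powM_lt1; rewrite ?normrN norm_sqr_lt1.
have n3 : 1 + x != 0 by rewrite -[x]opprK subr1_neq0// normrN.
have n4 : 1 + x ^+ 2 != 0 by rewrite -[x ^+ 2]opprK subr1_neq0// normrN norm_sqr_lt1.
have e3 : (Q ^+ 2) ^+ n.+1 = (Q * Q ^+ n) ^+ 2 by rewrite -exprS -!exprM mulnC.
rewrite e3 in n2; rewrite e3 exprMn (exprS x n) (exprS Q n).
by field; do ! [apply/andP; split].
Qed.

(** Two independent parameters: the functional equation shifts only t, by P = Q^2. Starting from (x
    Q, x) it gives (x Q, x Q^2), and the symmetry [u_termC] identifies this with the same family at
    x Q. *)
Definition u_term P x t (n : nat) : K :=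
  (x * t) ^+ n * P ^+ 'C(n, 2) * qpoch (- P) P n / (qpoch x P n.+1 * qpoch t P n.+1).

Lemma u_termC P x t : u_term P x t = u_term P t x.
Proof.
by apply/funext => n; rewrite /u_term (mulrC x) (mulrC (qpoch x _ _)).
Qed.

Lemma u_term_le P (r : K) : `|P| < 1 -> 0 <= r < 1 ->
  exists2 B : K, 0 <= B &
    forall x t n, `|x| <= r -> `|t| <= r -> `|u_term P x t n| <= B * r ^+ n.
Proof.
move=> P1 /andP[r0 r1].
have [||B1 B10 h1] := @qpoch_le _ Kc 1 `|P|; rewrite ?normr_ge0//.
have [||B2 B20 h2] := @qpochV_le _ Kc r `|P|; rewrite ?normr_ge0 ?r0//.
exists (B1 * (B2 * B2)); first by rewrite !mulr_ge0// ltW.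
move=> x t n xr tr.
have -> : u_term P x t n = (qpoch (- P) P n * ((qpoch x P n.+1)^-1 * (qpoch t P n.+1)^-1))
    * ((x * t) ^+ n * P ^+ 'C(n, 2)) by rewrite /u_term invfM; ring.
rewrite !normrM !normrX; apply: ler_pM; rewrite ?mulr_ge0 ?exprn_ge0//.
  apply: ler_pM; rewrite ?mulr_ge0//; first by apply: h1; rewrite ?normrN// ltW.
  by apply: ler_pM => //; [have [] := h2 x P n.+1 | have [] := h2 t P n.+1].
rewrite -[leRHS]mulr1 ler_pM ?exprn_ge0 ?mulr_ge0//.
  rewrite lerXn2r// ?nnegrE ?mulr_ge0// normrM -[leRHS]mulr1 ler_pM//.
  by rewrite (le_trans tr)// ltW.
by rewrite exprn_ile1// ltW.
Qed.

Lemma u_term_geom P x t : `|P| < 1 -> `|x| < 1 -> `|t| < 1 -> geom_bounded (u_term P x t).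
Proof.
move=> P1 x1 t1.
have -> : u_term P x t = fun n => (x * t) ^+ n *
    (P ^+ 'C(n, 2) * (qpoch (- P) P n * ((qpoch x P n.+1)^-1 * (qpoch t P n.+1)^-1))).
  by apply/funext => n; rewrite /u_term invfM; ring.
apply: geom_boundedM; first by apply: geom_boundedX => //; rewrite normrM mulr_ilt1.
apply: boundedM; first by apply: boundedX; exact: ltW.
apply: boundedM; first exact: bounded_qpoch.
have bV y : `|y| < 1 -> bounded (fun n => (qpoch y P n.+1)^-1).
  by move=> y1; have [B B0 h] := bounded_qpochV Kc y1 P1; exists B.
by apply: boundedM; exact: bV.
Qed.

Lemma u_sum_rec P x t : `|P| < 1 -> `|x| < 1 -> `|t| < 1 ->
  (1 - t) * infsum (u_term P x t)
  = 1 + x * (1 + t) * infsum (u_term P x (t * P)).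
Proof.
move=> P1 x1 t1; have tP1 : `|t * P| < 1 by rewrite -[P]expr1 norm_powM_lt1.
pose G n := (1 - t) * u_term P x t n * (1 - x * P ^+ n).
apply/eqP; rewrite -subr_eq; apply/eqP.
have G0 : G 0%N = 1.
  rewrite /G /u_term !qpochS !qpoch0 bin_small// !expr0 !(mulr1, mul1r).
  by have := subr1_neq0 x1; have := subr1_neq0 t1 => h1 h2; field; rewrite h1 h2.
rewrite -[RHS]G0; apply: infsum_sub_telescope.
- by apply: Kc; exact: u_term_geom.
- by apply: Kc; exact: u_term_geom.
- apply: (geom_bounded_cvg0 Kc).
  have -> : G = (fun n => u_term P x t n * ((1 - t) * (1 + - x * P ^+ n))).
    by apply/funext => n; rewrite /G; ring.
  apply: geom_boundedM; first exact: u_term_geom.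
  apply: boundedM; first exact: bounded_cst.
  apply: boundedD; first exact: bounded_cst.
  by apply: boundedM; [exact: bounded_cst | apply: boundedX; exact: ltW].
move=> n; rewrite /G /u_term.
have e1 : qpoch (t * P) P n.+1 = qpoch t P n.+2 / (1 - t).
  by rewrite [in RHS]qpochSl mulrAC mulfV ?mul1r ?subr1_neq0.
have n1 := @qpoch_neq0 _ Kc x P n.+1 x1 P1; have n2 := @qpoch_neq0 _ Kc t P n.+1 t1 P1.
have n3 := subr1_neq0 (norm_powM_lt1 n.+1 x1 P1).
have n4 := subr1_neq0 (norm_powM_lt1 n.+1 t1 P1).
have n5 := subr1_neq0 t1.
rewrite e1 (qpochS _ _ n.+1) (qpochS x _ n.+1) (qpochS (- P) _ n) exprbin2.
move: n1 n2 n3 n4; move: (qpoch x _ _) (qpoch t _ _) => A B.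
rewrite !exprS !exprMn => n1 n2 n3 n4.
by field; do ! [apply/andP; split].
Qed.

Section AtPowers.
Variables (x Q : K).
Hypotheses (x1 : `|x| < 1) (Q1 : `|Q| < 1).

Let xk k : `|x * Q ^+ k| <= `|x|.
Proof. by rewrite normrM normrX ler_piMr// exprn_ile1// ltW. Qed.

Lemma infsum_k_term :
  infsum (fun n => x ^+ n * Q ^+ 'C(n.+1, 2) * qpoch (- x) Q n / qpoch x Q n.+1)
  = infsum (k_term Q x).
Proof.
rewrite (@iterated_recurrence x Q (fun k => infsum (k_term Q (x * Q ^+ k))))//.
- by rewrite expr0 mulr1.
- have [|B B0 h] := @k_term_le Q `|x| Q1; first by rewrite normr_ge0.
  exists (B / (1 - `|x|)); first by rewrite divr_ge0// subr_ge0 ltW.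
  move=> k; apply: infsum_norm_le => //; last by move=> n; exact: h.
    by apply: Kc; apply: k_term_geom => //; exact: norm_powM_lt1.
  by rewrite normr_ge0.
- move=> k; rewrite k_sum_rec//; last exact: norm_powM_lt1.
  by rewrite exprSr mulrA.
Qed.

Lemma infsum_u_term :
  infsum (fun n => x ^+ n * Q ^+ 'C(n.+1, 2) * qpoch (- x) Q n / qpoch x Q n.+1)
  = infsum (u_term (Q ^+ 2) (x * Q) x).
Proof.
have Q21 := norm_sqr_lt1 Q1.
rewrite (@iterated_recurrence x Q
  (fun k => infsum (u_term (Q ^+ 2) (x * Q ^+ k.+1) (x * Q ^+ k))))//.
- by rewrite expr0 mulr1.
- have [|B B0 h] := @u_term_le (Q ^+ 2) `|x| Q21; first by rewrite normr_ge0.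
  exists (B / (1 - `|x|)); first by rewrite divr_ge0// subr_ge0 ltW.
  move=> k; apply: infsum_norm_le => //; last by move=> n; exact: h.
    by apply: Kc; apply: u_term_geom => //; exact: norm_powM_lt1.
  by rewrite normr_ge0.
- move=> k; rewrite u_sum_rec//; try exact: norm_powM_lt1.
  have -> : x * Q ^+ k * Q ^+ 2 = x * Q ^+ k.+2 by rewrite -mulrA -exprD addn2.
  have e : x * Q ^+ k.+1 = x * Q ^+ k * Q by rewrite -mulrA -exprSr.
  by rewrite [in RHS]u_termC -e.
Qed.

End AtPowers.

End Iteration.

(** * Domination of the Hecke-type series *)

Section Bounds.
Variable K : numFieldType.
Implicit Types (u v : nat -> K) (q : K).

Lemma geom_boundedD u v : geom_bounded u -> geom_bounded v ->
  geom_bounded (fun n => u n + v n).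
Proof.
move=> [C [r [C0 /andP[r0 r1] uC]]] [D [s [D0 /andP[s0 s1] vD]]].
have r1' : 0 <= 1 - r by rewrite subr_ge0 ltW.
have s1' : 0 <= 1 - s by rewrite subr_ge0 ltW.
(* A rate dominating r and s that needs no comparison of r with s. *)
pose t := 1 - (1 - r) * (1 - s).
have rt : r <= t.
  by rewrite -subr_ge0 (_ : t - r = (1 - r) * s) ?mulr_ge0// /t; ring.
have st : s <= t.
  by rewrite -subr_ge0 (_ : t - s = (1 - s) * r) ?mulr_ge0// /t; ring.
have t0 : 0 <= t by exact: le_trans rt.
exists (C + D), t; split; first exact: addr_ge0.
  by rewrite t0 /t ltrBlDr ltrDl mulr_gt0// subr_gt0.
move=> n; rewrite (le_trans (ler_normD _ _))// mulrDl lerD//.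
  by rewrite (le_trans (uC n))// ler_wpM2l// lerXn2r.
by rewrite (le_trans (vD n))// ler_wpM2l// lerXn2r.
Qed.

Lemma geom_bounded_unshift u : geom_bounded (fun n => u n.+1) -> geom_bounded u.
Proof.
(* As r may be 0, it cannot be divided by. The rate t = (1 + r) / 2 is at least 1/2 and dominates r,
   so C t^n <= 2 C t^(n+1). *)
move=> [C [r [C0 /andP[r0 r1] uC]]]; pose t := (1 + r) / 2.
have rt : r <= t.
  rewrite /t ler_pdivlMr// mulr_natr mulr2n lerD2r; exact: ltW.
have t0 : 0 <= t by exact: le_trans rt.
exists (`|u 0%N| + 2 * C), t; split.
- by rewrite addr_ge0// mulr_ge0.
- by rewrite t0 /t ltr_pdivrMr// mul1r mulr2n ltrD2l.
case=> [|n]; first by rewrite expr0 mulr1 lerDl mulr_ge0.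
rewrite (le_trans (uC n))// (@le_trans _ _ (C * t ^+ n))//.
  by rewrite ler_wpM2l// lerXn2r.
rewrite exprS mulrA ler_wpM2r ?exprn_ge0//.
rewrite (@le_trans _ _ (2 * C * t))//; last by rewrite ler_wpM2r// lerDr.
by rewrite /t (_ : 2 * C * _ = C + C * r) ?lerDl ?mulr_ge0//; field.
Qed.

Lemma geom_boundedZ c u : geom_bounded u -> geom_bounded (fun n => c * u n).
Proof.
move=> ub; have -> : (fun n => c * u n) = (fun n => u n * c).
  by apply/funext => n; rewrite mulrC.
by apply: geom_boundedM => //; exact: bounded_cst.
Qed.

(* Turns sum w_n alpha_n, with alpha_n a difference of consecutive terms, into the
   series over n of the statement. *)
Lemma geom_bounded_abel (g h w : nat -> K) : geom_complete K ->
  geom_bounded g -> geom_bounded h ->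
  w 0%N = g 0%N -> (forall n, w n.+1 = g n.+1 - h n) ->
  geom_bounded w /\ infsum w = infsum (fun n => g n - h n).
Proof.
move=> Kc gb hb w0 wS.
have hNb : geom_bounded (fun n => - 1 * h n) by exact: geom_boundedZ.
have wSE : (fun n => w n.+1) = (fun n => g n.+1 + -1 * h n).
  by apply/funext => n; rewrite wS mulN1r.
have wSb : geom_bounded (fun n => w n.+1).
  by rewrite wSE; apply: geom_boundedD => //; exact: geom_boundedS.
split; first exact: geom_bounded_unshift.
rewrite infsumS; last exact: Kc.
have -> : (fun n => g n - h n) = (fun n => g n + -1 * h n).
  by apply/funext => n; rewrite mulN1r.
rewrite infsumD; [|exact: Kc|exact: Kc].
rewrite (@infsumS _ g); last by apply: Kc; exact: geom_boundedS.
rewrite wSE infsumD; [|apply: Kc; exact: geom_boundedS|exact: Kc].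
by rewrite w0 addrA.
Qed.

(** [Z] grows at most like q^(-m n); the outer exponent a n exceeds m n by at least n, and this
    surplus is the geometric majorant. *)
Lemma geom_bounded_weighted q (Z x : nat -> K) (a m : nat -> nat) : `|q| < 1 ->
  bounded (fun n => q ^+ m n * Z n) -> bounded x ->
  (forall n, (m n + n <= a n)%N) -> geom_bounded (fun n => q ^+ a n * x n * Z n).
Proof.
move=> q1 Zb xb man.
have -> : (fun n => q ^+ a n * x n * Z n) =
    (fun n => q ^+ (a n - m n) * (x n * (q ^+ m n * Z n))).
  apply/funext => n; rewrite -[in LHS](@subnK (m n) (a n)) ?exprD; last first.
    by have := man n; lia.
  by ring.
apply: geom_boundedM; last exact: boundedM.
by apply: geom_boundedX => // n; have := man n; lia.
Qed.

Lemma bounded_sign : bounded (fun n => (-1) ^+ n : K).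
Proof. by exists 1 => // n; rewrite normrX normrN1 expr1n. Qed.

Definition triangular_sum q (n : nat) : K := \sum_(0 <= j < n) q ^- ((j * (j + 1)) %/ 2).

Lemma triangular_sum_rec q n : q != 0 ->
  triangular_sum q (2 * n.+1).+1 = triangular_sum q (2 * n).+1
    + q ^- (2 * n.+1 ^ 2 + n.+1) * (1 + q ^+ (2 * n + 2)).
Proof.
move=> q0; rewrite (_ : (2 * n.+1).+1 = (2 * n).+3); last by lia.
rewrite /triangular_sum !big_nat_recr//= -addrA; congr (_ + _).
rewrite (_ : ((2 * n).+1 * ((2 * n).+1 + 1) %/ 2 = 2 * n ^ 2 + 3 * n + 1)%N); last first.
  by rewrite (_ : (_ * _ = (2 * n ^ 2 + 3 * n + 1) * 2)%N) ?mulnK//; lia.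
rewrite (_ : ((2 * n).+2 * ((2 * n).+2 + 1) %/ 2 = 2 * n ^ 2 + 5 * n + 3)%N); last first.
  by rewrite (_ : (_ * _ = (2 * n ^ 2 + 5 * n + 3) * 2)%N) ?mulnK//; lia.
rewrite (_ : (2 * n.+1 ^ 2 + n.+1 = (2 * n ^ 2 + 3 * n + 1) + (2 * n + 2))%N); last by lia.
rewrite (_ : (2 * n ^ 2 + 5 * n + 3 = (2 * n ^ 2 + 3 * n + 1) + (2 * n + 2))%N); last by lia.
move: (2 * n ^ 2 + 3 * n + 1)%N (2 * n + 2)%N => a b.
by rewrite exprD; field; do ! [apply/andP; split]; rewrite expf_neq0.
Qed.

Section Weights.
Variable q : K.
Hypotheses (q0 : q != 0) (q1 : `|q| < 1).

Let qX (f : nat -> nat) : bounded (fun n => q ^+ f n).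
Proof. by apply: boundedX; exact: ltW. Qed.

(** Normalised by the power of its newest terms, an inner sum obeys a recurrence whose multiplier is
    a positive power of q and whose increment is bounded. *)
Let contract (Z b : nat -> K) (m k : nat -> nat) :
  (forall n, (0 < k n)%N) -> bounded b ->
  (forall n, q ^+ m n.+1 * Z n.+1 = q ^+ k n * (q ^+ m n * Z n) + b n) ->
  bounded (fun n => q ^+ m n * Z n).
Proof.
move=> k0 bb rec; apply: (@bounded_contraction _ _ (fun n => q ^+ k n) b `|q|) => //.
  by rewrite normr_ge0.
move=> n; rewrite normrX; case: (k n) (k0 n) => // i _.
by rewrite exprS ler_piMr// exprn_ile1// ltW.
Qed.

Lemma bounded_heckeS : bounded (fun n => q ^+ (2 * n ^ 2) * heckeS q n).
Proof.
apply: (@contract _ (fun n => 2 * ((-1) * (-1) ^+ n)) _ (fun n => 4 * n + 2)%N).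
- by move=> n; lia.
- by apply: boundedM; [exact: bounded_cst | apply: boundedM;
    [exact: bounded_cst | exact: bounded_sign]].
move=> n; rewrite heckeS_rec// [in RHS]mulrA -[in RHS]exprD.
rewrite (_ : (4 * n + 2 + 2 * n ^ 2 = 2 * n.+1 ^ 2)%N); last by lia.
have : q ^+ (2 * n.+1 ^ 2) != 0 by rewrite expf_neq0.
by move: (q ^+ (2 * n.+1 ^ 2)) => y y0; rewrite exprS; field.
Qed.

Lemma bounded_heckeT : bounded (fun n => q ^+ (2 * n ^ 2 + n) * heckeT q n).
Proof.
apply: (@contract _ (fun n => ((-1) * (-1) ^+ n) * (1 + q ^+ (2 * n + 2))) _
  (fun n => 4 * n + 3)%N).
- by move=> n; lia.
- apply: boundedM; first by apply: boundedM; [exact: bounded_cst | exact: bounded_sign].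
  by apply: boundedD; [exact: bounded_cst | exact: qX].
move=> n; rewrite heckeT_rec// [in RHS]mulrA -[in RHS]exprD.
rewrite (_ : (4 * n + 3 + (2 * n ^ 2 + n) = 2 * n.+1 ^ 2 + n.+1)%N); last by lia.
have : q ^+ (2 * n.+1 ^ 2 + n.+1) != 0 by rewrite expf_neq0.
by move: (q ^+ (2 * n.+1 ^ 2 + n.+1)) => y y0; rewrite exprS; field.
Qed.

Lemma bounded_heckeT0 : bounded (fun n => q ^+ (2 * n ^ 2 + 3 * n) * heckeT0 q n).
Proof.
apply: (@contract _ (fun n => ((-1) * (-1) ^+ n) * (1 + -1 * q ^+ (2 * n + 3))) _
  (fun n => 4 * n + 5)%N).
- by move=> n; lia.
- apply: boundedM; first by apply: boundedM; [exact: bounded_cst | exact: bounded_sign].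
  apply: boundedD; first exact: bounded_cst.
  by apply: boundedM; [exact: bounded_cst | exact: qX].
move=> n; rewrite heckeT0_rec// [in RHS]mulrA -[in RHS]exprD.
rewrite (_ : (4 * n + 5 + (2 * n ^ 2 + 3 * n) = 2 * n.+1 ^ 2 + 3 * n.+1)%N); last by lia.
have : q ^+ (2 * n.+1 ^ 2 + 3 * n.+1) != 0 by rewrite expf_neq0.
by move: (q ^+ (2 * n.+1 ^ 2 + 3 * n.+1)) => y y0; rewrite exprS; field.
Qed.

Lemma bounded_triangular_sum :
  bounded (fun n => q ^+ (2 * n ^ 2 + n) * triangular_sum q (2 * n).+1).
Proof.
apply: (@contract _ (fun n => 1 + q ^+ (2 * n + 2)) _ (fun n => 4 * n + 3)%N).
- by move=> n; lia.
- by apply: boundedD; [exact: bounded_cst | exact: qX].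
move=> n; rewrite triangular_sum_rec// [in RHS]mulrA -[in RHS]exprD.
rewrite (_ : (4 * n + 3 + (2 * n ^ 2 + n) = 2 * n.+1 ^ 2 + n.+1)%N); last by lia.
have : q ^+ (2 * n.+1 ^ 2 + n.+1) != 0 by rewrite expf_neq0.
by move: (q ^+ (2 * n.+1 ^ 2 + n.+1)) => y y0; field.
Qed.

End Weights.

Lemma signz_even (m : int) : (-1) ^ (2 * m) = 1 :> K.
Proof. by rewrite -exprz_exp (_ : (-1) ^ 2 = 1 :> K) ?exp1rz// -exprnP sqrrN expr1n. Qed.

Lemma exprzN q (e : int) : (- q) ^ e = (-1) ^ e * q ^ e.
Proof. by rewrite -[- q]mulN1r expfzMl. Qed.

(** At - q the signs cancel because j + (-2 j^2 - j) is even; this is the passage from T1 to V1. *)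
Lemma heckeTN q n :
  heckeT (- q) n = zsum (- n%:Z) n%:Z (fun j : int => q ^ (- 2%:Z * j ^+ 2 - j)).
Proof.
apply: eq_zsum => j; rewrite /weightT exprzN mulrA -expfzDr ?oppr_eq0 ?oner_neq0//.
by rewrite (_ : j + _ = 2 * (- j ^+ 2)) ?signz_even ?mul1r//; lia.
Qed.

(** At - q the signs cancel, and 2 j^2 + 3 j + 1 = (2j + 1)(2j + 2) / 2 is triangular. For j from
    -n-1 to n these are the triangular numbers of index 0 to 2n + 1, each once; the last is written
    apart. *)
Lemma heckeT0N q n : q != 0 ->
  heckeT0 (- q) n = q * (triangular_sum q (2 * n).+1 + q ^- (2 * n ^ 2 + 3 * n + 1)).
Proof.
move=> q0.
have wE j : weightT0 (- q) j = q ^ (- 2%:Z * j ^+ 2 - 3%:Z * j).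
  rewrite /weightT0 exprzN mulrA -expfzDr ?oppr_eq0 ?oner_neq0//.
  by rewrite (_ : j + _ = 2 * (- j ^+ 2 - j)) ?signz_even ?mul1r//; lia.
elim: n => [|n IH].
  rewrite heckeT0_0 /triangular_sum big_nat1 expr0 expr1 invr1.
  by field.
rewrite heckeT0_rec ?oppr_eq0// IH triangular_sum_rec//. rewrite !(exprNn q).
have -> : (-1) ^+ (2 * n.+1 ^ 2 + 3 * n.+1) = (-1) ^+ n.+1 :> K.
  by rewrite -signr_odd -[RHS]signr_odd; congr (_ ^+ _); congr nat_of_bool; lia.
have -> : (-1) ^+ (2 * n + 3) = -1 :> K.
  by rewrite -signr_odd (_ : odd _ = true)//; lia.
have -> : (2 * n.+1 ^ 2 + n.+1 = (2 * n ^ 2 + 3 * n + 1) + (2 * n + 2))%N by lia.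
have -> : (2 * n.+1 ^ 2 + 3 * n.+1 = (2 * n ^ 2 + 3 * n + 1) + (2 * n + 2) + (2 * n + 2))%N.
  by lia.
have -> : (2 * n + 3 = (2 * n + 2) + 1)%N by lia.
have : (-1) ^+ n.+1 != 0 :> K by rewrite signr_eq0.
have := sqrr_sign K n.+1; move: ((-1) ^+ n.+1) => e e2 e0.
move: (2 * n ^ 2 + 3 * n + 1)%N (2 * n + 2)%N (triangular_sum _ _) => a b S.
have -> : e * (e * q ^+ (a + b + b))^-1 = (q ^+ (a + b + b))^-1.
  by rewrite invfM mulrA mulfV// mul1r.
rewrite !exprD expr1.
by field; do ! [apply/andP; split]; rewrite // expf_neq0.
Qed.
End Bounds.

(** * The eighth order functions *)

Section EighthOrder.
Variable K : numFieldType.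
Hypothesis Kc : geom_complete K.

Lemma rpoch_l0 (p : K) n : rpoch 0 p n = (-1) ^+ n * p ^+ 'C(n, 2).
Proof.
elim: n => [|n IH]; first by rewrite rpoch0 bin_small// !expr0 mulr1.
by rewrite rpochS IH exprbin2 exprS; ring.
Qed.

(** The case [s] = 0 of [bailey_lemma]. The constant [k] takes the power of q in the leading term:
    q^2 for T0, q for V1, 1 otherwise. *)
Lemma bailey_lemma_limit (p rho c b k : K) (beta t w : nat -> K) :
  p != 0 -> `|p| < 1 -> `|c| < 1 -> `|b| < 1 -> rho * c = b ->
  geom_bounded t -> geom_bounded w ->
  (forall n, t n = k * (qpoch rho p n * ((-1) ^+ n * p ^+ 'C(n, 2) * c ^+ n) * beta n)) ->
  k != 0 ->
  (forall n, w n = qpoch rho p n * ((-1) ^+ n * p ^+ 'C(n, 2) * c ^+ n) / qpoch c p n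
     * bailey_alpha b p beta n) ->
  infsum t = k * (qpoch_inf c p / qpoch_inf b p * infsum w).
Proof.
move=> p0 p1 c1 b1 bE tb wb tE k0; rewrite -{}bE in b1 * => wE.
have := @bailey_lemma _ Kc p rho c 0 beta p0 p1 c1.
rewrite !mulr0 normr0 ltr01 qpoch_inf_l0 => /(_ b1 isT isT).
set w' := fun n => _; set o := fun n => _; rewrite /=.
have -> : w' = w.
  apply/funext => n; rewrite /w' wE rpoch_l0 qpoch_l0 mulr1.
  by congr (_ / _ * _); rewrite !mulrA.
have tE' : t = fun n => k * o n.
  by apply/funext => n; rewrite tE /o rpoch_l0; congr (_ * (_ * _)); rewrite !mulrA.
have ob : geom_bounded o.
  have -> : o = fun n => k^-1 * t n by apply/funext => n; rewrite tE' mulKf.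
  exact: geom_boundedZ.
move=> /(_ wb ob); rewrite tE' infsumZ; last exact: Kc.
by move=> ->; rewrite !mulr1.
Qed.

Lemma sqr_bin_sign (q : K) m n :
  (-1) ^+ n * (q ^+ 2) ^+ 'C(n, 2) * (- q ^+ m.+1) ^+ n = q ^+ (n ^ 2 + m * n).
Proof.
rewrite [(- q ^+ m.+1) ^+ n]exprNn mulrACA -expr2 sqrr_sign mul1r.
rewrite (exprS q m) (exprMn n q) mulrA exprD (exprM q m n).
congr (_ * _); case: n => [|n]; first by rewrite bin_small// !expr0 mulr1.
by rewrite sqr_exprbin2 -exprD; congr (_ ^+ _); lia.
Qed.

Section Main.
Variable q : K.
Hypotheses (q0 : q != 0) (q1 : `|q| < 1).

Let qX1 n : `|q ^+ n.+1| < 1. Proof. by rewrite normrX exprn_ilt1. Qed.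
Let NqX1 n : `|- q ^+ n.+1| < 1. Proof. by rewrite normrN. Qed.
Let Nq1 : `|- q| < 1. Proof. by rewrite normrN. Qed.
Let p0 : q ^+ 2 != 0. Proof. by rewrite expf_neq0. Qed.
Let pp0 n : qpoch (q ^+ 2) (q ^+ 2) n != 0. Proof. exact: qpoch_neq0. Qed.

Let qXb (f : nat -> nat) : bounded (fun n => q ^+ f n).
Proof. by apply: boundedX; exact: ltW. Qed.

Let oneB (f : nat -> nat) : bounded (fun n => 1 - q ^+ f n).
Proof.
have -> : (fun n => 1 - q ^+ f n) = (fun n => 1 + -1 * q ^+ f n).
  by apply/funext => n; rewrite mulN1r.
apply: boundedD; first exact: bounded_cst.
by apply: boundedM; [exact: bounded_cst | exact: qXb].
Qed.

Lemma geom_pochratio (x y : K) (f g h : nat -> nat) : `|y| < 1 ->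
  (forall n, (n <= f n)%N) ->
  geom_bounded (fun n => q ^+ f n * qpoch x (q ^+ 2) (g n) / qpoch y (q ^+ 2) (h n)).
Proof.
move=> y1 nf.
have -> : (fun n => q ^+ f n * qpoch x (q ^+ 2) (g n) / qpoch y (q ^+ 2) (h n)) =
  (fun n => q ^+ f n * (qpoch x (q ^+ 2) (g n) * (qpoch y (q ^+ 2) (h n))^-1)).
  by apply/funext => n; rewrite mulrA.
apply: geom_boundedM; first exact: geom_boundedX.
have [B B0 hB] := bounded_qpoch Kc x (qX1 1).
have [C C0 hC] := bounded_qpochV Kc y1 (qX1 1).
by apply: boundedM; [exists B | exists C].
Qed.

Lemma geom_S0 : geom_bounded (S0_term q).
Proof. by apply: geom_pochratio => // n; nia. Qed.
Lemma geom_S1 : geom_bounded (S1_term q).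
Proof. by apply: geom_pochratio => // n; nia. Qed.
Lemma geom_T0 : geom_bounded (T0_term q).
Proof. by apply: geom_pochratio => // n; nia. Qed.
Lemma geom_T1 : geom_bounded (T1_term q).
Proof. by apply: geom_pochratio => // n; nia. Qed.
Lemma geom_V0 : geom_bounded (V0_term q).
Proof. by apply: geom_pochratio => // n; nia. Qed.
Lemma geom_V1 : geom_bounded (V1_term q).
Proof. by apply: geom_pochratio => // n; nia. Qed.

Definition s0_term (n : nat) : K :=
  q ^+ (4 * n ^ 2 + n) * (1 - q ^+ (6 * n + 3)) * heckeS q n.
Definition s1_term (n : nat) : K :=
  q ^+ (4 * n ^ 2 + 3 * n) * (1 - q ^+ (2 * n + 1)) * heckeS q n.
Definition t0_term (n : nat) : K :=
  q ^+ (4 * n ^ 2 + 7 * n) * (1 - q ^+ (2 * n + 2)) * heckeT0 q n.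
Definition t1_term (n : nat) : K :=
  q ^+ (4 * n ^ 2 + 3 * n) * (1 - q ^+ (2 * n + 1)) * heckeT q n.
Definition v0_term (n : nat) : K :=
  (-1) ^+ n * q ^+ (4 * n ^ 2 + 2 * n)
  * (triangular_sum q (2 * n).+1 * (1 + q ^+ (4 * n + 2))).
Definition v1_term (n : nat) : K :=
  (-1) ^+ n * q ^+ (4 * n ^ 2 + 4 * n) * heckeT (- q) n.

Lemma geom_s0 : geom_bounded s0_term.
Proof.
by apply: (geom_bounded_weighted q1 (bounded_heckeS q0 q1)) => // n; nia.
Qed.
Lemma geom_s1 : geom_bounded s1_term.
Proof.
by apply: (geom_bounded_weighted q1 (bounded_heckeS q0 q1)) => // n; nia.
Qed.
Lemma geom_t0 : geom_bounded t0_term.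
Proof.
by apply: (geom_bounded_weighted q1 (bounded_heckeT0 q0 q1)) => // n; nia.
Qed.
Lemma geom_t1 : geom_bounded t1_term.
Proof.
by apply: (geom_bounded_weighted q1 (bounded_heckeT q0 q1)) => // n; nia.
Qed.

Let oneD (f : nat -> nat) : bounded (fun n => 1 + q ^+ f n).
Proof. by apply: boundedD; [exact: bounded_cst | exact: qXb]. Qed.

Lemma geom_v0 : geom_bounded v0_term.
Proof.
have -> : v0_term = fun n => q ^+ (4 * n ^ 2 + 2 * n) * ((-1) ^+ n * (1 + q ^+ (4 * n + 2)))
    * triangular_sum q (2 * n).+1 by apply/funext => n; rewrite /v0_term; ring.
apply: (geom_bounded_weighted q1 (bounded_triangular_sum q0 q1)) => [|n]; last by nia.
by apply: boundedM => //; exact: bounded_sign.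
Qed.

Lemma geom_v1 : geom_bounded v1_term.
Proof.
have -> : v1_term = fun n => (- q) ^+ (4 * n ^ 2 + 4 * n) * (-1) ^+ n * heckeT (- q) n.
  apply/funext => n; rewrite /v1_term; congr (_ * _); rewrite mulrC; congr (_ * _).
  rewrite [RHS]exprNn (_ : (-1) ^+ _ = 1) ?mul1r//.
  by rewrite -signr_odd (_ : odd _ = false)//; lia.
have q0' : - q != 0 by rewrite oppr_eq0.
apply: (geom_bounded_weighted Nq1 (bounded_heckeT q0' Nq1)) => [|n]; last by nia.
exact: bounded_sign.
Qed.

Let q2_neq1 : 1 - q ^+ 2 != 0. Proof. exact: subr1_neq0. Qed.

Let Nq n : 1 + q ^+ n.+1 != 0.
Proof. by rewrite -[q ^+ _]opprK; exact: subr1_neq0. Qed.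

Let infN1 : qpoch_inf (- q) (q ^+ 2) = (1 + q) * qpoch_inf (- q ^+ 3) (q ^+ 2).
Proof. by rewrite (qpoch_infS Kc (- q))// opprK mulNr -exprS. Qed.

Let inf2 : qpoch_inf (q ^+ 2) (q ^+ 2) = (1 - q ^+ 2) * qpoch_inf (q ^+ 2 * q ^+ 2) (q ^+ 2).
Proof. by rewrite (qpoch_infS Kc). Qed.

(** Evaluates (rho)_n / (c)_n when c = rho q^2. Its denominator divides the very-well-poised factor,
    a difference of squares, and leaves the linear factor of the Hecke series. *)
Let poch_ratio m n : qpoch (- q ^+ m.+1) (q ^+ 2) n
  = (1 + q ^+ m.+1) / (1 + q ^+ (2 * n + m.+1)) * qpoch (- q ^+ m.+3) (q ^+ 2) n.
Proof.
have := qpochS (- q ^+ m.+1) (q ^+ 2) n; rewrite qpochSl opprK !mulNr opprK -exprM -!exprD.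
rewrite addn2 addnC => h; have := Nq (2 * n + m); rewrite -addnS => f.
by rewrite mulrAC h mulfK.
Qed.

Let pX n : q ^+ 2 * (q ^+ 2) ^+ (2 * n) = (q ^+ (2 * n + 1)) ^+ 2.
Proof. by rewrite -!exprM -exprD; congr (_ ^+ _); lia. Qed.

Lemma S1_hecke :
  S1 q = qpoch_inf (- q) (q ^+ 2) / qpoch_inf (q ^+ 2) (q ^+ 2) * infsum s1_term.
Proof.
have w_geom := geom_boundedZ ((1 + q) / (1 - q ^+ 2)) geom_s1.
rewrite /S1 (@bailey_lemma_limit (q ^+ 2) (- q) (- q ^+ 3) (q ^+ 2 * q ^+ 2) 1
   (fun n => (qpoch (- q ^+ 2) (q ^+ 2) n)^-1) _ _ p0 (qX1 1) (NqX1 2) _ _ geom_S1 w_geom).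
- rewrite infN1 inf2 infsumZ; last exact/Kc/geom_s1.
  have := qpoch_inf_neq0 Kc (qX1 3) (qX1 1); rewrite (exprD q 2 2) => h.
  by field; rewrite q2_neq1 h.
- by rewrite -exprD; exact: (qX1 3).
- by ring.
- by move=> n; rewrite sqr_bin_sign /S1_term mul1r; congr (_ / _); rewrite mulrC;
    congr (_ * _ ^+ _); lia.
- exact: oner_neq0.
move=> n; rewrite sqr_bin_sign bailey_alpha_prod// bailey_sum_S//; last first.
  by move=> m; exact: (qpoch_neq0 Kc m (NqX1 1) (qX1 1)).
have h := poch_ratio 0 n; rewrite expr1 in h; rewrite h /s1_term.
have n1 := qpoch_neq0 Kc n (NqX1 2) (qX1 1); have n2 := Nq (2 * n); rewrite -addn1 in n2.
rewrite pX (_ : q ^+ (4 * n ^ 2 + 3 * n) = q ^+ (n ^ 2 + 2 * n) * q ^+ (3 * n ^ 2 + n)); last first.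
  by rewrite -exprD; congr (_ ^+ _); lia.
move: (q ^+ (2 * n + 1)) n2 => y n2.
by field; do ! [apply/andP; split].
Qed.

(** Here rho = c = -q^2, so the Pochhammer ratio is 1; the factor 1 + q^(2n+1) dividing 1 - q^(4n+2)
    comes from [bailey_sum_T] instead. *)
Lemma T1_hecke :
  T1 q = qpoch_inf (- q ^+ 2) (q ^+ 2) / qpoch_inf (q ^+ 2) (q ^+ 2) * infsum t1_term.
Proof.
have w_geom := geom_boundedZ (1 - q ^+ 2)^-1 geom_t1.
rewrite /T1 (@bailey_lemma_limit (q ^+ 2) (- q ^+ 2) (- q ^+ 2) (q ^+ 2 * q ^+ 2) 1
   (fun n => (qpoch (- q) (q ^+ 2) n.+1)^-1) _ _ p0 (qX1 1) (NqX1 1) _ _ geom_T1 w_geom).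
- rewrite inf2 infsumZ; last exact/Kc/geom_t1.
  have := qpoch_inf_neq0 Kc (qX1 3) (qX1 1); rewrite (exprD q 2 2) => h.
  by field; rewrite q2_neq1 h.
- by rewrite -exprD; exact: (qX1 3).
- by ring.
- move=> n; rewrite sqr_bin_sign /T1_term mul1r addn1; congr (_ / _); rewrite mulrC.
  by congr (_ * _ ^+ _); lia.
- exact: oner_neq0.
move=> n; rewrite sqr_bin_sign bailey_alpha_prod//.
have n1 := qpoch_neq0 Kc n (NqX1 1) (qX1 1); have n2 := Nq (2 * n); rewrite -addn1 in n2.
have := bailey_sum_T q0 pp0 (fun m => qpoch_neq0 Kc m Nq1 (qX1 1)) n.
move=> /(canRL (mulKf n2)) ->; rewrite /t1_term pX.
rewrite (_ : q ^+ (4 * n ^ 2 + 3 * n) = q ^+ (n ^ 2 + 1 * n) * q ^+ (3 * n ^ 2 + 2 * n)); last first.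
  by rewrite -exprD; congr (_ ^+ _); lia.
move: (q ^+ (2 * n + 1)) n2 => y n2.
by field; do ! [apply/andP; split].
Qed.

Lemma T0_hecke :
  T0 q = q ^+ 2 * (qpoch_inf (- q ^+ 2) (q ^+ 2) / qpoch_inf (q ^+ 2) (q ^+ 2))
         * infsum t0_term.
Proof.
have w_geom := geom_boundedZ ((1 + q ^+ 2) / ((1 - q ^+ 4) * (1 - q ^+ 2))) geom_t0.
have q4 : 1 - q ^+ 2 * q ^+ 2 != 0 by rewrite -exprD; exact: (subr1_neq0 (qX1 3)).
have q4' : 1 - q ^+ 4 != 0 := subr1_neq0 (qX1 3).
rewrite /T0 (@bailey_lemma_limit (q ^+ 2) (- q ^+ 2) (- q ^+ 4) (q ^+ 2 * q ^+ 2 * q ^+ 2) (q ^+ 2)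
   (fun n => (qpoch (- q) (q ^+ 2) n.+1)^-1) _ _ p0 (qX1 1) (NqX1 3) _ _ geom_T0 w_geom).
- rewrite inf2 infsumZ; last exact/Kc/geom_t0.
  rewrite (qpoch_infS Kc (q ^+ 2 * q ^+ 2))// (qpoch_infS Kc (- q ^+ 2))//.
  have := qpoch_inf_neq0 Kc (qX1 5) (qX1 1); rewrite (exprD q 4 2) !(exprD q 2 2) mulNr -exprD => h.
  by field; do ! [apply/andP; split].
- by rewrite -!exprD; exact: (qX1 5).
- by ring.
- move=> n; rewrite sqr_bin_sign /T0_term addn1 !mulrA; congr (_ / _); rewrite mulrAC -exprD.
  by congr (_ ^+ _ * _); lia.
- exact: p0.
move=> n; rewrite sqr_bin_sign bailey_alpha_prod//.
have n1 := qpoch_neq0 Kc n (NqX1 3) (qX1 1); have n2 := Nq (2 * n + 1); rewrite -addnS in n2.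
have := bailey_sum_T0 q0 pp0 (fun m => qpoch_neq0 Kc m Nq1 (qX1 1)) n.
move=> /(canRL (mulKf q2_neq1)) ->; rewrite /t0_term (poch_ratio 1).
rewrite (_ : q ^+ (4 * n ^ 2 + 7 * n) = q ^+ (n ^ 2 + 3 * n) * q ^+ (3 * n ^ 2 + 4 * n)); last first.
  by rewrite -exprD; congr (_ ^+ _); lia.
rewrite (_ : q ^+ 2 * q ^+ 2 * (q ^+ 2) ^+ (2 * n) = (q ^+ (2 * n + 2)) ^+ 2); last first.
  by rewrite -!exprM -!exprD; congr (_ ^+ _); lia.
move: (q ^+ (2 * n + 2)) n2 => y n2.
by field; do ! [apply/andP; split].
Qed.

(** Uses the pair of T1 at - q. Its factor 1 - q^(2n+1) and the factor 1 + q^(2n+1) of [poch_ratio]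
    together cancel 1 - q^(4n+2), so no linear factor remains. *)
Lemma V1_hecke :
  V1 q = q * (qpoch_inf (- q) (q ^+ 2) / qpoch_inf (q ^+ 2) (q ^+ 2)) * infsum v1_term.
Proof.
have w_geom := geom_boundedZ ((1 + q) / (1 - q ^+ 2)) geom_v1.
have q0' : - q != 0 by rewrite oppr_eq0.
rewrite /V1 (@bailey_lemma_limit (q ^+ 2) (- q) (- q ^+ 3) (q ^+ 2 * q ^+ 2) q
   (fun n => (qpoch q (q ^+ 2) n.+1)^-1) _ _ p0 (qX1 1) (NqX1 2) _ _ geom_V1 w_geom).
- rewrite infN1 inf2 infsumZ; last exact/Kc/geom_v1.
  have := qpoch_inf_neq0 Kc (qX1 3) (qX1 1); rewrite (exprD q 2 2) => h.
  by field; rewrite q2_neq1 h.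
- by rewrite -exprD; exact: (qX1 3).
- by ring.
- move=> n; rewrite sqr_bin_sign /V1_term addn1 !mulrA; congr (_ / _); rewrite mulrAC -exprS.
  by congr (_ ^+ _ * _); lia.
- exact: q0.
move=> n; rewrite sqr_bin_sign bailey_alpha_prod//.
have n1 := qpoch_neq0 Kc n (NqX1 2) (qX1 1); have n2 := Nq (2 * n); rewrite -addn1 in n2.
have n3 : 1 - q ^+ (2 * n + 1) != 0 by rewrite addn1; exact: (subr1_neq0 (qX1 _)).
have := @bailey_sum_T _ (- q) q0'; rewrite sqrrN opprK => /(_ pp0).
move=> /(_ (fun m => qpoch_neq0 Kc m q1 (qX1 1)) n).
have -> : (- q) ^+ (2 * n + 1) = - q ^+ (2 * n + 1).
  by rewrite exprNn -signr_odd (_ : odd _ = true) ?expr1 ?mulN1r//; lia.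
have -> : (- q) ^+ (3 * n ^ 2 + 2 * n) = (-1) ^+ n * q ^+ (3 * n ^ 2 + 2 * n).
  rewrite (exprNn q); congr (_ * _); rewrite -signr_odd -[RHS]signr_odd.
  by rewrite oddD !oddM; case: (odd n).
move=> /(canRL (mulKf n3)) ->.
have h := poch_ratio 0 n; rewrite expr1 in h; rewrite h /v1_term pX.
rewrite (_ : q ^+ (4 * n ^ 2 + 4 * n) = q ^+ (n ^ 2 + 2 * n) * q ^+ (3 * n ^ 2 + 2 * n)); last first.
  by rewrite -exprD; congr (_ ^+ _); lia.
move: (q ^+ (2 * n + 1)) n2 n3 => y n2 n3.
by field; do ! [apply/andP; split].
Qed.

(** Since a = 1, [bailey_alpha_diff] gives w_(n+1) = g_(n+1) - h_n; regrouping by the index of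
    [heckeS] yields g_n - h_n, the source of 1 - q^(6n+3). *)
Lemma S0_hecke :
  S0 q = qpoch_inf (- q) (q ^+ 2) / qpoch_inf (q ^+ 2) (q ^+ 2) * infsum s0_term.
Proof.
pose beta n := (qpoch (- q ^+ 2) (q ^+ 2) n)^-1.
pose w n := q ^+ (n ^ 2) * bailey_alpha (q ^+ 2) (q ^+ 2) beta n.
pose g n := q ^+ (4 * n ^ 2 + n) * 1 * heckeS q n.
pose h n := q ^+ (4 * n ^ 2 + 7 * n + 3) * 1 * heckeS q n.
have e0 m := qpoch_neq0 Kc m (NqX1 1) (qX1 1).
have [||||wb wsum] := @geom_bounded_abel _ g h w Kc.
- by apply: (geom_bounded_weighted q1 (bounded_heckeS q0 q1)) => [|n];
    [exact: bounded_cst|nia].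
- by apply: (geom_bounded_weighted q1 (bounded_heckeS q0 q1)) => [|n];
    [exact: bounded_cst|nia].
- by rewrite /w /g bailey_alpha0 /beta qpoch0 heckeS0 !(mulr1, invr1).
- move=> n; rewrite /w bailey_alpha_diff// !bailey_sum_S// /g /h.
  have -> : q ^+ (4 * n.+1 ^ 2 + n.+1) = q ^+ (n.+1 ^ 2) * q ^+ (3 * n.+1 ^ 2 + n.+1).
    by rewrite -exprD; congr (_ ^+ _); lia.
  have -> : q ^+ (4 * n ^ 2 + 7 * n + 3)
      = q ^+ (n.+1 ^ 2) * (q ^+ 2 * (q ^+ 2) ^+ (2 * n) * q ^+ (3 * n ^ 2 + n)).
    by rewrite -!exprM -!exprD; congr (_ ^+ _); lia.
  by ring.
rewrite /S0 (@bailey_lemma_limit (q ^+ 2) (- q) (- q ^+ 1) (q ^+ 2) 1 beta _ _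
   p0 (qX1 1) (NqX1 0) (qX1 1) _ geom_S0 wb).
- rewrite expr1 wsum mul1r; congr (_ * infsum _); apply/funext => n.
  rewrite /g /h /s0_term !mulr1 -mulrBl; congr (_ * _); rewrite mulrBr mulr1 -exprD.
  by congr (_ - _ ^+ _); lia.
- by ring.
- by move=> n; rewrite sqr_bin_sign /S0_term mul1r mul0n addn0 [q ^+ _ * _]mulrC.
- exact: oner_neq0.
move=> n; rewrite sqr_bin_sign mul0n addn0 expr1 /w.
by have := qpoch_neq0 Kc n Nq1 (qX1 1) => ?; field.
Qed.

Lemma V0_hecke :
  infsum (V0_term q)
  = qpoch_inf (- q) (q ^+ 2) / qpoch_inf (q ^+ 2) (q ^+ 2) * infsum v0_term.
Proof.
pose beta n := (qpoch q (q ^+ 2) n)^-1.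
pose S n := triangular_sum q (2 * n).+1.
pose w n := q ^+ (n ^ 2) * bailey_alpha (q ^+ 2) (q ^+ 2) beta n.
pose g n := q ^+ (4 * n ^ 2 + 2 * n) * (-1) ^+ n * S n.
pose h n := q ^+ (4 * n ^ 2 + 6 * n + 2) * (-1 * (-1) ^+ n) * S n.
have q0' : - q != 0 by rewrite oppr_eq0.
have [||||wb wsum] := @geom_bounded_abel _ g h w Kc.
- by apply: (geom_bounded_weighted q1 (bounded_triangular_sum q0 q1)) => [|n];
    [exact: bounded_sign|nia].
- by apply: (geom_bounded_weighted q1 (bounded_triangular_sum q0 q1)) => [|n];
    [apply: boundedM; [exact: bounded_cst|exact: bounded_sign]|nia].
- by rewrite /w /g bailey_alpha0 /beta qpoch0 /S /triangular_sum big_nat1 !mulr1 !expr0.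
- move=> n; rewrite /w bailey_alpha_head//.
  have f := subr1_neq0 (qX1 (2 * n).+1).
  have := @bailey_sum_T0 _ (- q) q0'; rewrite sqrrN opprK => /(_ pp0).
  move=> /(_ (fun m => qpoch_neq0 Kc m q1 (qX1 1)) n) ->.
  have -> : (- q) ^+ (3 * n ^ 2 + 4 * n) = (-1) ^+ n * q ^+ (3 * n ^ 2 + 4 * n).
    rewrite (exprNn q); congr (_ * _); rewrite -signr_odd -[RHS]signr_odd.
    by rewrite oddD !oddM; case: (odd n).
  rewrite heckeT0N// -/(S n) /beta qpoch0 invr1 mulr1 sqr_exprbin2 (exprS (-1)).
  rewrite /g /h -[S n.+1]/(triangular_sum q (2 * n.+1).+1) triangular_sum_rec// -/(S n).
  have -> : (q ^+ 2) ^+ (2 * n.+1) = (q ^+ (2 * n).+2) ^+ 2.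
    by rewrite -!exprM; congr (_ ^+ _); lia.
  have -> : (q ^+ 2) ^+ n.+1 = q ^+ (2 * n).+2.
    by rewrite -exprM; congr (_ ^+ _); lia.
  have -> : (2 * n + 2 = (2 * n).+2)%N by lia.
  have -> : (2 * n.+1 ^ 2 + n.+1 = (2 * n ^ 2 + 3 * n + 1) + (2 * n).+2)%N by lia.
  (* [A] is the triangular number of index 2n + 1. The split-off head and the extra term q^(-A) of
     [heckeT0N] combine into the two terms that complete S_n to S_(n+1). *)
  set A := (2 * n ^ 2 + 3 * n + 1)%N.
  have E1 : q ^+ (n.+1 ^ 2) = q ^+ A / q ^+ (n * n + n).
    apply/(canRL (mulfK _)); first by rewrite expf_neq0.
    by rewrite -exprD; congr (_ ^+ _); rewrite /A; lia.
  have E2 : q ^+ (3 * n ^ 2 + 4 * n) = q ^+ A * q ^+ (n * n + n) / q.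
    apply/(canRL (mulfK _)) => //.
    by rewrite -exprD -exprSr; congr (_ ^+ _); rewrite /A; lia.
  have E3 : q ^+ (4 * n.+1 ^ 2 + 2 * n.+1) = (q ^+ A * q ^+ (2 * n).+2) ^+ 2.
    by rewrite -exprD -exprM; congr (_ ^+ _); rewrite /A; lia.
  have E4 : q ^+ (4 * n ^ 2 + 6 * n + 2) = (q ^+ A) ^+ 2.
    by rewrite -exprM; congr (_ ^+ _); rewrite /A; lia.
  rewrite E1 E2 E3 E4 (exprD q A) (exprS (-1) n); move: f.
  have : q ^+ A != 0 by rewrite expf_neq0.
  have : q ^+ (n * n + n) != 0 by rewrite expf_neq0.
  have : q ^+ (2 * n).+2 != 0 by rewrite expf_neq0.
  move: (q ^+ A) (q ^+ (n * n + n)) (q ^+ (2 * n).+2) => a b c c0 b0 a0 f.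
  by field; do ! [apply/andP; split].
rewrite (@bailey_lemma_limit (q ^+ 2) (- q) (- q ^+ 1) (q ^+ 2) 1 beta _ _
   p0 (qX1 1) (NqX1 0) (qX1 1) _ geom_V0 wb).
- rewrite expr1 wsum mul1r; congr (_ * infsum _); apply/funext => n.
  rewrite /g /h /v0_term -/(S n) (_ : (4 * n ^ 2 + 6 * n + 2 = 4 * n ^ 2 + 2 * n + (4 * n + 2))%N).
    by move: (4 * n ^ 2 + 2 * n)%N (4 * n + 2)%N => a b; rewrite exprD; ring.
  by lia.
- by ring.
- by move=> n; rewrite sqr_bin_sign /V0_term mul1r mul0n addn0 [q ^+ _ * _]mulrC.
- exact: oner_neq0.
move=> n; rewrite sqr_bin_sign mul0n addn0 expr1 /w.
by have := qpoch_neq0 Kc n Nq1 (qX1 1) => ?; field.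
Qed.

Lemma boundedV_sub (y : nat -> K) : (forall n, `|y n| <= `|q|) ->
  bounded (fun n => (1 - y n)^-1).
Proof.
move=> yq; have q1' : 0 < 1 - `|q| by rewrite subr_gt0.
exists (1 - `|q|)^-1 => [|n]; first by rewrite invr_ge0 ltW.
have h : 1 - `|q| <= `|1 - y n|.
  by rewrite (le_trans _ (lerB_dist _ _))// normr1 lerB.
by rewrite normfV lef_pV2 ?posrE// (lt_le_trans q1').
Qed.

Let qX_le n : `|q ^+ n.+1| <= `|q|.
Proof. by rewrite normrX exprS ler_piMr// exprn_ile1// ltW. Qed.

(** * The two single-sum representations of V1 *)

Definition v1'_term (n : nat) : K :=
  (-1) ^+ n * ((1 - q ^+ (2 * n + 1)) / (1 + q ^+ (4 * n + 2))) * q ^+ (n ^ 2 + 2 * n).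

Definition v1''_term (n : int) : K :=
  ((-1) ^ n * q ^ ((2%:Z * n + 1) ^+ 2)) / (1 - q ^ (4%:Z * n + 1)).

Lemma geom_v1' : geom_bounded v1'_term.
Proof.
have -> : v1'_term = fun n => q ^+ (n ^ 2 + 2 * n) *
    ((-1) ^+ n * ((1 - q ^+ (2 * n + 1)) * (1 - - q ^+ (4 * n + 1).+1)^-1)).
  by apply/funext => n; rewrite /v1'_term opprK -addnS mulrC.
apply: geom_boundedM; first by apply: geom_boundedX => // n; nia.
apply: boundedM; first exact: bounded_sign.
apply: boundedM.
  exists 2 => // n; rewrite (le_trans (ler_normB _ _))// normr1 mulr2n lerD2l.
  by rewrite normrX exprn_ile1// ltW.
by apply: boundedV_sub => n; rewrite normrN.
Qed.

Lemma v1''_termE n : v1''_term n%:Z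
  = (-1) ^+ n * q ^+ ((2 * n + 1) ^ 2) / (1 - q ^+ (4 * n + 1)).
Proof.
rewrite /v1''_term (@exprz_eq _ q _ ((2 * n + 1) ^ 2)); last by lia.
by rewrite (@exprz_eq _ q _ (4 * n + 1)); last by lia.
Qed.

(** The squares at -(n + 1) and n coincide; clearing the negative power in the denominator produces
    q^(4n+3) and one more sign. *)
Lemma v1''_termNE n : v1''_term (- n.+1%:Z)
  = (-1) ^+ n * q ^+ ((2 * n + 1) ^ 2) * q ^+ (4 * n + 3) / (1 - q ^+ (4 * n + 3)).
Proof.
rewrite /v1''_term (@signz_eqN _ _ n.+1)// (@exprz_eq _ q _ ((2 * n + 1) ^ 2)); last by lia.
rewrite (@exprz_eqN _ q _ (4 * n + 3)); last by lia.
have : 1 - q ^+ (4 * n + 3) != 0 by rewrite addnS; exact: subr1_neq0.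
have : q ^+ (4 * n + 3) != 0 by rewrite expf_neq0.
move: (q ^+ (4 * n + 3)) => y y0 y1; rewrite exprS; field.
by rewrite y0 y1 -opprB oppr_eq0 y1.
Qed.

Lemma geom_v1''_pos : geom_bounded (fun n => v1''_term n%:Z).
Proof.
have -> : (fun n => v1''_term n%:Z) = fun n => q ^+ ((2 * n + 1) ^ 2) *
    ((-1) ^+ n * (1 - q ^+ (4 * n).+1)^-1).
  by apply/funext => n; rewrite v1''_termE (addn1 (4 * n)); ring.
apply: geom_boundedM; first by apply: geom_boundedX => // n; nia.
by apply: boundedM; [exact: bounded_sign | exact: boundedV_sub].
Qed.

Lemma geom_v1''_neg : geom_bounded (fun n => v1''_term (- n.+1%:Z)).
Proof.
have -> : (fun n => v1''_term (- n.+1%:Z)) = fun n => q ^+ ((2 * n + 1) ^ 2 + (4 * n + 3)) *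
    ((-1) ^+ n * (1 - q ^+ (4 * n + 2).+1)^-1).
  by apply/funext => n; rewrite v1''_termNE (exprD q ((2 * n + 1) ^ 2))
    -[(4 * n + 2).+1]addnS; ring.
apply: geom_boundedM; first by apply: geom_boundedX => // n; nia.
by apply: boundedM; [exact: bounded_sign | exact: boundedV_sub].
Qed.

Lemma rpoch_invr (p : K) n : p != 0 ->
  rpoch (- p^-1) p n = (- p^-1) ^+ n * qpoch (- p) p n.
Proof.
move=> p_neq0; elim: n => [|n IH]; first by rewrite rpoch0 qpoch0 expr0 mulr1.
by rewrite rpochS qpochS IH exprS; field.
Qed.

(** From (n + 1)^2 = 1 + n + n (n + 1): V1 is q E(q) with Q = q^2. *)
Let V1_iterated : V1 q = q *
  infsum (fun n => q ^+ n * (q ^+ 2) ^+ 'C(n.+1, 2) * qpoch (- q) (q ^+ 2) n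
     / qpoch q (q ^+ 2) n.+1).
Proof.
rewrite -infsumZ.
  rewrite /V1; congr infsum; apply/funext => n; rewrite /V1_term addn1 sqr_exprbin2 !mulrA.
  by congr (_ * _ / _); rewrite -exprS -exprD; congr (_ ^+ _); lia.
apply: Kc.
have -> : (fun n => q ^+ n * (q ^+ 2) ^+ 'C(n.+1, 2) * qpoch (- q) (q ^+ 2) n
     / qpoch q (q ^+ 2) n.+1) = fun n => q^-1 * V1_term q n.
  apply/funext => n; rewrite /V1_term addn1 sqr_exprbin2.
  have -> : q ^+ (n.+1 ^ 2) = q * (q ^+ n * q ^+ (n * n + n)).
    by rewrite -exprD -exprS; congr (_ ^+ _); lia.
  by field; rewrite q0 (qpoch_neq0 Kc _ q1 (qX1 1)).
exact/geom_boundedZ/geom_V1.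
Qed.

(** Here the second parameter stays finite: rho1 = -q, rho2 = -q^2, that is s = -1 / q^2, with a =
    q^2. The beta 1 / (-q^2;q^4)_(n+1) is the case t = 0 of [bailey_sum_theta]. *)
Lemma V1_single_sum :
  V1 q = q * (qpoch_inf (- q) q / qpoch_inf q q) * infsum v1'_term.
Proof.
have q21 := qX1 1.
rewrite V1_iterated infsum_k_term// -mulrA; congr (_ * _).
pose beta n := (qpoch (- q ^+ 2) (q ^+ 2 ^+ 2) n.+1)^-1.
have := @bailey_lemma _ Kc (q ^+ 2) (- q) (- q ^+ 3) (- (q ^+ 2)^-1) beta p0 (qX1 1) (NqX1 2).
have -> : - q * - q ^+ 3 = q ^+ 2 * q ^+ 2 by ring.
have -> : q ^+ 2 * q ^+ 2 * - (q ^+ 2)^-1 = - q ^+ 2 by field.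
have -> : - q ^+ 3 * - (q ^+ 2)^-1 = q by field.
rewrite -[in `|q ^+ 2 * q ^+ 2|]exprD => /(_ (qX1 3) (NqX1 1) q1) /=.
set w := fun n => _; set o := fun n => _.
have -> : o = k_term (q ^+ 2) q.
  apply/funext => n; rewrite /o /k_term /beta rpoch_invr//.
  have -> : qpoch (- q) (q ^+ 2) n * ((- (q ^+ 2)^-1) ^+ n * qpoch (- q ^+ 2) (q ^+ 2) n)
      * (- q ^+ 3) ^+ n = ((- (q ^+ 2)^-1) ^+ n * (- q ^+ 3) ^+ n)
      * qpoch (- q) (q ^+ 2) n * qpoch (- q ^+ 2) (q ^+ 2) n by ring.
  by rewrite -exprMn; congr (_ ^+ _ * _ * _ / _); field.
pose k := (1 + q) / (1 - q ^+ 2).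
have w_eq : w = fun n => k * v1'_term n.
  apply/funext => n; rewrite /w bailey_alpha_prod//.
  have -> : bailey_sum (q ^+ 2) (q ^+ 2) beta n
      = (-1) ^+ n * q ^+ (n * n + n) / (1 + q ^+ (4 * n + 2)).
    have R_neq0 m : 1 - 0 * (q ^+ 2) ^+ m + (q ^+ 2) ^+ (2 * m).+1 != 0.
      by rewrite mul0r subr0 -exprM (_ : (2 * (2 * m).+1 = (4 * m + 1).+1)%N) ?Nq//; lia.
    have := bailey_sum_theta p0 pp0 R_neq0 n.
    rewrite sqr_exprbin2 mul0r subr0 -exprM (_ : (2 * (2 * n).+1 = 4 * n + 2)%N); last by lia.
    move=> <-; congr bailey_sum; apply/funext => j; rewrite /beta /qpoch; congr (_^-1).
    apply: eq_bigr => m _; rewrite mul0r subr0 mulNr opprK -!exprM -exprD.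
    by congr (_ + _ ^+ _); lia.
  have n1 := qpoch_neq0 Kc n (NqX1 2) (qX1 1); have n2 := Nq (2 * n); rewrite -addn1 in n2.
  have n3 := qpoch_neq0 Kc n (NqX1 1) (qX1 1); have n4 := Nq (4 * n + 1); rewrite -addnS in n4.
  have h := poch_ratio 0 n; rewrite expr1 in h.
  have -> : qpoch (- q) (q ^+ 2) n * rpoch (- (q ^+ 2)^-1) (q ^+ 2) n * (- q ^+ 3) ^+ n
      = ((- (q ^+ 2)^-1) ^+ n * (- q ^+ 3) ^+ n)
      * qpoch (- q) (q ^+ 2) n * qpoch (- q ^+ 2) (q ^+ 2) n by rewrite rpoch_invr//; ring.
  rewrite -exprMn (_ : - (q ^+ 2)^-1 * - q ^+ 3 = q); last by field.
  rewrite h pX /v1'_term /k (_ : q ^+ (n ^ 2 + 2 * n) = q ^+ n * q ^+ (n * n + n)); last first.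
    by rewrite -exprD; congr (_ ^+ _); lia.
  move: (q ^+ (2 * n + 1)) (q ^+ (4 * n + 2)) n2 n4 => y z n2 n4.
  by field; do ! [apply/andP; split].
have w_geom : geom_bounded w by rewrite w_eq; apply: geom_boundedZ; exact: geom_v1'.
move=> /(_ w_geom (k_term_geom Kc q21 q1)) ->.
rewrite w_eq infsumZ; last exact/Kc/geom_v1'.
rewrite !(qpoch_inf_sqr Kc _ q1) infN1 -!expr2 inf2 mulNr -expr2.
have h1 := qpoch_inf_neq0 Kc q1 (qX1 1).
have := qpoch_inf_neq0 Kc (qX1 3) (qX1 1); rewrite (exprD q 2 2) => h2.
by rewrite /k; field; do ! [apply/andP; split].
Qed.

(** Base q^4, a = q^4 and t = q + q^3. With X = q^(4n+1) and Y = q^(4n+3), the partial fraction (1 -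
    X Y) / ((1 - X)(1 - Y)) = 1 / (1 - X) + Y / (1 - Y) splits each term into the bilateral terms of
    index n and -n - 1. *)
Lemma V1_appell :
  V1 q = qpoch_inf (- q ^+ 4) (q ^+ 4) / qpoch_inf (q ^+ 4) (q ^+ 4) * zinfsum v1''_term.
Proof.
have p4_neq1 : 1 - q ^+ 4 != 0 := subr1_neq0 (qX1 3).
have p40 : q ^+ 4 != 0 by rewrite expf_neq0.
have pp40 n : qpoch (q ^+ 4) (q ^+ 4) n != 0 by exact: (qpoch_neq0 Kc n (qX1 3) (qX1 3)).
have qsum : summable (fun n => v1''_term n%:Z) by apply: Kc; exact: geom_v1''_pos.
have qsumN : summable (fun n => v1''_term (- n.+1%:Z)) by apply: Kc; exact: geom_v1''_neg.
rewrite V1_iterated (infsum_u_term Kc q1 (qX1 1)).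
rewrite -exprM -exprS.
pose beta n := (qpoch (q ^+ 3) (q ^+ 4) n.+1 * qpoch q (q ^+ 4) n.+1)^-1.
pose k := (1 - q ^+ 4)^-1 * q^-1.
pose v n := v1''_term n%:Z + v1''_term (- n.+1%:Z).
have v_geom : geom_bounded v.
  by apply: geom_boundedD; [exact: geom_v1''_pos | exact: geom_v1''_neg].
have w_geom := geom_boundedZ k v_geom.
have t_geom := u_term_geom Kc (qX1 3) (qX1 2) q1.
rewrite (@bailey_lemma_limit (q ^+ 4) (- q ^+ 4) (- q ^+ 4) (q ^+ 4 * q ^+ 4) 1 beta _ _
   p40 (qX1 3) (NqX1 3) _ _ t_geom w_geom).
- rewrite infsumZ; last exact: Kc.
  rewrite (infsumD qsum qsumN) -/(zinfsum v1''_term).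
  have := qpoch_inf_neq0 Kc (qX1 7) (qX1 3); rewrite (exprD q 4 4) => h.
  rewrite (qpoch_infS Kc (q ^+ 4) (qX1 3)) /k.
  by field; do ! [apply/andP; split].
- by rewrite -exprD; exact: (qX1 7).
- by ring.
- move=> n; rewrite /u_term /beta mul1r -exprSr [(- q ^+ 4) ^+ n]exprNn.
  have := sqrr_sign K n; rewrite expr2; move: ((-1) ^+ n) => e e2.
  by rewrite mulrACA [e * _]mulrC -!mulrA [e * (e * _)]mulrA e2 mul1r; ring.
- exact: oner_neq0.
move=> n; rewrite bailey_alpha_prod//.
have RE m : 1 - (q + q ^+ 3) * (q ^+ 4) ^+ m + (q ^+ 4) ^+ (2 * m).+1
    = (1 - q ^+ 3 * (q ^+ 4) ^+ m) * (1 - q * (q ^+ 4) ^+ m).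
  by rewrite (exprS (q ^+ 4)) mul2n -addnn exprD; ring.
have R_neq0 m : 1 - (q + q ^+ 3) * (q ^+ 4) ^+ m + (q ^+ 4) ^+ (2 * m).+1 != 0.
  by rewrite RE mulf_neq0//; apply/subr1_neq0/norm_powM_lt1 => //; exact: qX1.
have -> : bailey_sum (q ^+ 4) (q ^+ 4) beta n
    = (-1) ^+ n * (q ^+ 4) ^+ 'C(n.+1, 2)
      / ((1 - q ^+ 3 * (q ^+ 4) ^+ n) * (1 - q * (q ^+ 4) ^+ n)).
  rewrite -RE -(bailey_sum_theta p40 pp40 R_neq0); congr bailey_sum.
  apply/funext => j; rewrite /beta /qpoch -big_split/=; congr (_^-1).
  by apply: eq_bigr => m _; rewrite RE.
have n1 := qpoch_neq0 Kc n (NqX1 3) (qX1 3).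
have n2 := subr1_neq0 (norm_powM_lt1 n (qX1 2) (qX1 3)).
have n3 := subr1_neq0 (norm_powM_lt1 n q1 (qX1 3)).
have E1 : q ^+ ((2 * n + 1) ^ 2) = q * ((q ^+ 4) ^+ 'C(n.+1, 2)) ^+ 2.
  have -> : (q ^+ 4) ^+ 'C(n.+1, 2) = q ^+ (2 * (n * n + n)).
    by rewrite (exprM q 2 2) [LHS]exprAC sqr_exprbin2 -exprM mulnC.
  by rewrite -exprM -exprS; congr (_ ^+ _); lia.
have E2 : q ^+ (4 * n + 1) = q * (q ^+ 4) ^+ n by rewrite -exprM -exprS addn1.
have E3 : q ^+ (4 * n + 3) = q ^+ 3 * (q ^+ 4) ^+ n by rewrite -exprM -exprD addnC.
have E4 : (q ^+ 4) ^+ (2 * n) = (q ^+ 4) ^+ n * (q ^+ 4) ^+ n by rewrite mul2n -addnn exprD.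
rewrite /v v1''_termE v1''_termNE E1 E2 E3 E4 /k exprbin2 [(- q ^+ 4) ^+ n]exprNn.
have := sqrr_sign K n; move: ((-1) ^+ n) => e e2.
set y := (q ^+ 4) ^+ n; set c := (q ^+ 4) ^+ 'C(n, 2).
have -> : e * c * (e * y) = c * y by rewrite mulrACA -expr2 e2 mul1r.
by field; do ! [apply/andP; split].
Qed.

End Main.
End EighthOrder.

Theorem theorem8p2 (R : realType) (q : R[i]) (hq : 0 < `|q| < 1) :
  let s0 (n : nat) : R[i] :=
    q ^+ (4 * n ^ 2 + n) * (1 - q ^+ (6 * n + 3))
    * zsum (- n%:Z) n%:Z (fun j : int => (-1) ^ j * q ^ (- 2%:Z * j ^+ 2)) in
  let s1 (n : nat) : R[i] :=
    q ^+ (4 * n ^ 2 + 3 * n) * (1 - q ^+ (2 * n + 1))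
    * zsum (- n%:Z) n%:Z (fun j : int => (-1) ^ j * q ^ (- 2%:Z * j ^+ 2)) in
  let t0 (n : nat) : R[i] :=
    q ^+ (4 * n ^ 2 + 7 * n) * (1 - q ^+ (2 * n + 2))
    * zsum (- n%:Z - 1) n%:Z
        (fun j : int => (-1) ^ j * q ^ (- 2%:Z * j ^+ 2 - 3%:Z * j)) in
  let t1 (n : nat) : R[i] :=
    q ^+ (4 * n ^ 2 + 3 * n) * (1 - q ^+ (2 * n + 1))
    * zsum (- n%:Z) n%:Z
        (fun j : int => (-1) ^ j * q ^ (- 2%:Z * j ^+ 2 - j)) in
  let v0 (n : nat) : R[i] :=
    (-1) ^+ n * q ^+ (4 * n ^ 2 + 2 * n)
    * \sum_(0 <= j < (2 * n).+1)
        q ^- ((j * (j + 1)) %/ 2) * (1 + q ^+ (4 * n + 2)) in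
  let v1 (n : nat) : R[i] :=
    (-1) ^+ n * q ^+ (4 * n ^ 2 + 4 * n)
    * zsum (- n%:Z) n%:Z (fun j : int => q ^ (- 2%:Z * j ^+ 2 - j)) in
  let v1' (n : nat) : R[i] :=
    (-1) ^+ n * ((1 - q ^+ (2 * n + 1)) / (1 + q ^+ (4 * n + 2)))
    * q ^+ (n ^ 2 + 2 * n) in
  let v1'' (n : int) : R[i] :=
    ((-1) ^ n * q ^ ((2%:Z * n + 1) ^+ 2)) / (1 - q ^ (4%:Z * n + 1)) in
  (* all the infinite products and series below converge *)
  [/\ forall x p : R[i], `|p| < 1 -> qpoch_cvg x p,
      [/\ summable (S0_term q), summable (S1_term q), summable (T0_term q)
        & summable (T1_term q)]
      /\ summable (V0_term q) /\ summable (V1_term q),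
      [/\ summable s0, summable s1, summable t0 & summable t1]
    & [/\ summable v0, summable v1, summable v1' & zsummable v1'']]
  /\
  S0 q = qpoch_inf (- q) (q ^+ 2) / qpoch_inf (q ^+ 2) (q ^+ 2) * infsum s0
  /\
  S1 q = qpoch_inf (- q) (q ^+ 2) / qpoch_inf (q ^+ 2) (q ^+ 2) * infsum s1
  /\
  T0 q = q ^+ 2 * (qpoch_inf (- q ^+ 2) (q ^+ 2) / qpoch_inf (q ^+ 2) (q ^+ 2))
         * infsum t0
  /\
  T1 q = qpoch_inf (- q ^+ 2) (q ^+ 2) / qpoch_inf (q ^+ 2) (q ^+ 2) * infsum t1
  /\
  V0 q = - 1 + 2 * (qpoch_inf (- q) (q ^+ 2) / qpoch_inf (q ^+ 2) (q ^+ 2))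
               * infsum v0
  /\
  V1 q = q * (qpoch_inf (- q) (q ^+ 2) / qpoch_inf (q ^+ 2) (q ^+ 2))
         * infsum v1
  /\
  V1 q = q * (qpoch_inf (- q) q / qpoch_inf q q) * infsum v1'
  /\
  q * (qpoch_inf (- q) q / qpoch_inf q q) * infsum v1'
  = qpoch_inf (- q ^+ 4) (q ^+ 4) / qpoch_inf (q ^+ 4) (q ^+ 4) * zinfsum v1''.
Proof.
move: hq => /andP[q_gt0 q1]; have q0 : q != 0 by rewrite -normr_gt0.
move=> s0 s1 t0 t1 v0 v1 v1' v1''.
have Kc := @complex_geom_complete R.
have v0E : v0 = v0_term q.
  (* The statement keeps 1 + q^(4n+2) inside the inner sum, [v0_term] outside. *)
  apply/funext => n; rewrite /v0 /v0_term /triangular_sum mulr_suml.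
  by congr (_ * _).
have v1E : v1 = v1_term q by apply/funext => n; rewrite /v1 /v1_term heckeTN.
rewrite {}v0E {}v1E.
split; [split|].
- by move=> x p p1; exact: (qpoch_is_cvg Kc).
- split; [split|split]; apply: (Kc).
  + exact: (geom_S0 Kc).
  + exact: (geom_S1 Kc).
  + exact: (geom_T0 Kc).
  + exact: (geom_T1 Kc).
  + exact: (geom_V0 Kc).
  + exact: (geom_V1 Kc).
- split; apply: (Kc).
  + exact: geom_s0.
  + exact: geom_s1.
  + exact: geom_t0.
  + exact: geom_t1.
- split; [apply: (Kc)..|split; apply: (Kc)].
  + exact: geom_v0.
  + exact: geom_v1.
  + exact: geom_v1'.
  + exact: geom_v1''_pos.
  + exact: geom_v1''_neg.
split; first exact: (S0_hecke Kc).
split; first exact: (S1_hecke Kc).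
split; first exact: (T0_hecke Kc).
split; first exact: (T1_hecke Kc).
split; first by rewrite /V0 (V0_hecke Kc q0 q1) !mulrA.
split; first exact: (V1_hecke Kc).
split; first exact: (V1_single_sum Kc).
(* Both sides are values of V1, so the equivalence of the two representations needs no separate
   argument. *)
by rewrite -(V1_single_sum Kc q0 q1); exact: (V1_appell Kc).
Qed.
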